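(* Let $G$ be the fundamental group of a connected compact three-dimensional smooth manifold $M$ (possibly with boundary) with $\chi(M)=0$. Let $\rho:G\to GL_R(V)$ be a right representation, where $V$ is a free finitely generated $R$-module over a factorial commutative ring $R$. Let $\pi:G\to H$ be an epimorphism, where $H$ is a free abelian finitely generated group. Let $\xi:H\to\mathbb{R}$ be any non-trivial homomorphism. Then the Fitting invariant $A(G,\rho_\pi)$ and the twisted Alexander polynomial $\Delta_{G,\bar\rho}$ are equal up to multiplication by an invertible element of $\Lambda_{[\xi]}=\Sigma_\xi^{-1}\Lambda$, where $\Lambda=R[H]$.
   Context: A right representation is an anti-homomorphism: $\rho(ab)=\rho(b)\rho(a)$. Put $n=\mathrm{rk}\,V$. $\Sigma_\xi\subset\Lambda$ is the multiplicative set of elements with $\xi$-monic ends, i.e. elements $x=x_0h_0+\sum_{i=1}^{a-1}x_ih_i+x_ah_a$ with $x_i\in R$, $h_i\in H$, $x_0,x_a$ invertible in $R$ and $\xi(h_0)<\xi(h_i)<\xi(h_a)$ for all $0<i<a$. $V^H=\Lambda\otimes_RV$, $\rho_\pi(g)(\sum\lambda_i\otimes v_i)=\sum\pi(g)\lambda_i\otimes\rho(g)v_i$; $V^H$ is a right $\mathbb{Z}G$-module via $v\cdot g=\rho_\pi(g)v$. Let $(g_1,\dots,g_s\mid h_1,\dots,h_l)$ be a finite presentation of $G$ and $\mathcal{A}=(\partial h_i/\partial g_j)\in \mathrm{Mat}(l\times s,\mathbb{Z}G)$ its Alexander matrix (Fox derivatives). Fitting invariant: the trivial module $\mathbb{Z}$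 has a free resolution $F_*$ beginning with $\mathbb{Z}G\xleftarrow{\partial_1}(\mathbb{Z}G)^s\xleftarrow{\partial_2}(\mathbb{Z}G)^l\leftarrow\cdots$, $\partial_1(e_j)=1-g_j$, $\partial_2(f_i)=\sum_j(\partial h_i/\partial g_j)e_j$. $A(G,\rho_\pi)\in\Lambda$ is the GCD of all $n(s-1)\times n(s-1)$ minors of the matrix over $\Lambda$ of $\mathrm{id}\otimes\partial_2:V^H\otimes_{\mathbb{Z}G}F_2\to V^H\otimes_{\mathbb{Z}G}F_1$ (it is $0$ if all these minors vanish or if there are none because the size exceeds a dimension of the matrix, and $1$ if $n(s-1)=0$). Up to units of $\Lambda$ it does not depend on the choices. Twisted Alexander polynomial: choose a basis of $V$ and let $\bar\rho(g)$ be the matrix of $\rho(g)$ written row-wise ($\rho(g)e_i=\sum_jM_{ij}e_j$), so $\bar\rho:G\to GL(n,R)$ is a homomorphism; let $\psi:\mathbb{Z}G\to \mathrm{Mat}(n\times n,\Lambda)$ be the ring homomorphism $\psi(g)=\pi(g)\bar\rho(g)$, applied entrywise to matrices. Let $\mathcal{A}_j$ be $\mathcal{A}$ with the $j$-th column removed. Choose $j$ with $\det\psi(1-g_j)\neq0$, let $Q_j$ be the GCD of the $n(s-1)\times n(s-1)$ minors of $\psi(\mathcal{A}_j)$, and put $\Delta_{G,\bar\rho}=Q_j/\det\psi(1-g_j)\in\mathrm{Frac}(\Lambda)$ ($=0$ if $l<s-1$). Up to units of $\Lambda$ it does not depend on the choices. *)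

(* Defs.v *)
From HB Require Import structures.
From mathcomp Require Import all_boot all_order all_algebra fraction finmap.
From mathcomp Require Import boolp classical_sets functions reals topology normedtype derive.

Set Implicit Arguments.
Unset Strict Implicit.
Unset Printing Implicit Defensive.

Import Order.TTheory GRing.Theory Num.Theory.
Import numFieldNormedType.Exports.

Local Open Scope fset_scope.
Local Open Scope ring_scope.

(* [fsum R K] is the free R-module on K: finitely supported functions K -> R.
   When K is a group it is the group ring R[K]. *)
Section FreeModule.
Variables (R : nzRingType) (K : choiceType).

Record fsum : predArgType := FSum { fsval : {fsfun K -> R with 0} }.

HB.instance Definition _ := [isNew for fsval].
HB.instance Definition _ := [Choice of fsum by <:].

Implicit Types (x y : fsum) (k : K) (c : R).

Definition fcoef x k : R := fsval x k.
Definition fsupp x : {fset K} := finsupp (fsval x).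
Definition fU k : fsum := FSum [fsfun i in [fset k] => 1].

Lemma fsumP x y : (forall k, fcoef x k = fcoef y k) <-> x = y.
Proof.
by case: x y => [x] [y]; split=> [h|->//]; congr FSum; apply/fsfunP/h.
Qed.

Lemma fsuppE x k : (k \in fsupp x) = (fcoef x k != 0).
Proof. by rewrite mem_finsupp. Qed.

Lemma fcoef_out x k : k \notin fsupp x -> fcoef x k = 0.
Proof. exact: fsfun_dflt. Qed.

Lemma fcoefU k k' : fcoef (fU k) k' = (k' == k)%:R.
Proof. by rewrite /fcoef /= fsfunE inE; case: eqP. Qed.

Definition fzero : fsum := FSum [fsfun].
Definition fopp x : fsum := FSum [fsfun k in fsupp x => - fcoef x k].
Definition fadd x y : fsum :=
  FSum [fsfun k in fsupp x `|` fsupp y => fcoef x k + fcoef y k].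
Definition fscale c x : fsum := FSum [fsfun k in fsupp x => c * fcoef x k].

Let fzeroE k : fcoef fzero k = 0.
Proof. by rewrite /fcoef /= fsfunE. Qed.

Let foppE x k : fcoef (fopp x) k = - fcoef x k.
Proof.
rewrite {1}/fcoef /= fsfunE; case: ifPn => // /fcoef_out ->.
by rewrite oppr0.
Qed.

Let faddE x y k : fcoef (fadd x y) k = fcoef x k + fcoef y k.
Proof.
rewrite {1}/fcoef /= fsfunE inE; case: ifPn => //.
by rewrite negb_or => /andP[/fcoef_out -> /fcoef_out ->]; rewrite addr0.
Qed.

Let fscaleE c x k : fcoef (fscale c x) k = c * fcoef x k.
Proof.
rewrite {1}/fcoef /= fsfunE; case: ifPn => // /fcoef_out ->.
by rewrite mulr0.
Qed.

Fact faddA : associative fadd.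
Proof. by move=> x y z; apply/fsumP => k; rewrite !faddE addrA. Qed.
Fact faddC : commutative fadd.
Proof. by move=> x y; apply/fsumP => k; rewrite !faddE addrC. Qed.
Fact fadd0 : left_id fzero fadd.
Proof. by move=> x; apply/fsumP => k; rewrite faddE fzeroE add0r. Qed.
Fact faddN : left_inverse fzero fopp fadd.
Proof. by move=> x; apply/fsumP => k; rewrite faddE foppE fzeroE addNr. Qed.

HB.instance Definition _ := GRing.isZmodule.Build fsum faddA faddC fadd0 faddN.

Fact fscaleA c c' x : fscale c (fscale c' x) = fscale (c * c') x.
Proof. by apply/fsumP => k; rewrite !fscaleE mulrA. Qed.
Fact fscale1 : left_id 1 fscale.
Proof. by move=> x; apply/fsumP => k; rewrite fscaleE mul1r. Qed.
Fact fscaleDr : right_distributive fscale +%R.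
Proof. by move=> c x y; apply/fsumP => k; rewrite faddE !fscaleE faddE mulrDr. Qed.
Fact fscaleDl x : {morph fscale^~ x : c c' / c + c'}.
Proof. by move=> c c'; apply/fsumP => k; rewrite faddE !fscaleE mulrDl. Qed.

HB.instance Definition _ :=
  GRing.Zmodule_isLmodule.Build R fsum fscaleA fscale1 fscaleDr fscaleDl.

Lemma fcoef0 k : fcoef 0 k = 0. Proof. exact: fzeroE. Qed.
Lemma fcoefD x y k : fcoef (x + y) k = fcoef x k + fcoef y k.
Proof. exact: faddE. Qed.
Lemma fcoefN x k : fcoef (- x) k = - fcoef x k.
Proof. exact: foppE. Qed.
Lemma fcoefZ c x k : fcoef (c *: x) k = c * fcoef x k.
Proof. exact: fscaleE. Qed.

Lemma fcoef_sum I (r : seq I) (P : pred I) (F : I -> fsum) k :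
  fcoef (\sum_(i <- r | P i) F i) k = \sum_(i <- r | P i) fcoef (F i) k.
Proof. by elim/big_rec2: _ => [|i y z _ <-]; rewrite ?fcoef0 ?fcoefD. Qed.

Lemma fsum_neq0 x : x != 0 -> exists k, k \in fsupp x.
Proof.
move=> xn0; apply/not_existsP => h; case/negP: xn0; apply/eqP/fsumP => k.
by rewrite fcoef0 fcoef_out //; apply/negP/h.
Qed.

Definition fext (V : lmodType R) (f : K -> V) x : V :=
  \sum_(k <- fsupp x) fcoef x k *: f k.

Section Ext.
Variables (V : lmodType R) (f : K -> V).

Lemma fextw x (D : {fset K}) : fsupp x `<=` D ->
  fext f x = \sum_(k <- D) fcoef x k *: f k.
Proof.
move=> sD; apply: big_fset_incl => // k _ /fcoef_out ->.
by rewrite scale0r.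
Qed.

Lemma fextU k : fext f (fU k) = f k.
Proof.
rewrite (@fextw _ [fset k]) ?big_seq_fset1 ?fcoefU ?eqxx ?scale1r //.
by apply/fsubsetP => i; rewrite fsuppE fcoefU inE; case: (i == k) => //=; rewrite mulr0n eqxx.
Qed.

Fact fext_is_linear : linear (fext f).
Proof.
move=> c x y; pose D := fsupp x `|` fsupp y.
have sx : fsupp x `<=` D by apply: fsubsetUl.
have sy : fsupp y `<=` D by apply: fsubsetUr.
have sxy : fsupp (c *: x + y) `<=` D.
  apply/fsubsetP => k; apply: contraLR.
  rewrite in_fsetU negb_or [k \in fsupp (_ + _)]fsuppE negbK.
  move=> /andP[/fcoef_out xk /fcoef_out yk].
  by rewrite fcoefD fcoefZ xk yk mulr0 addr0.
rewrite (fextw sx) (fextw sy) (fextw sxy) scaler_sumr -big_split /=.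
by apply: eq_bigr => k _; rewrite fcoefD fcoefZ scalerDl scalerA.
Qed.

HB.instance Definition _ :=
  GRing.isLinear.Build R fsum V _ (fext f) fext_is_linear.

End Ext.

Lemma fextUid x : fext fU x = x.
Proof.
apply/fsumP => k; rewrite fcoef_sum.
rewrite (eq_bigr (fun i => if i == k then fcoef x k else 0)); last first.
  move=> i _; rewrite fcoefZ fcoefU eq_sym; case: eqP => [->|_].
    by rewrite mulr1.
  by rewrite mulr0.
have [ki|ki] := boolP (k \in fsupp x).
  rewrite (big_fsetD1 k ki) /= eqxx big1_seq ?addr0 // => i.
  by rewrite andTb in_fsetD1 => /andP[/negPf ->].
by rewrite fcoef_out // big1 // => i _; rewrite if_same.
Qed.

Lemma linear_fsumE (V : lmodType R) (f : {linear fsum -> V}) x :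
  f x = fext (fun k => f (fU k)) x.
Proof.
rewrite -{1}[x]fextUid /fext linear_sum.
by apply: eq_bigr => k _; rewrite linearZ.
Qed.

Lemma eq_linear_fsum (V : lmodType R) (f g : {linear fsum -> V}) :
  (forall k, f (fU k) = g (fU k)) -> f =1 g.
Proof.
by move=> fg x; rewrite (linear_fsumE f) (linear_fsumE g) /fext; apply: eq_bigr => k _; rewrite fg.
Qed.

End FreeModule.

Section GroupRing.
Variables (R : comNzRingType) (G : groupType).
Implicit Types x y z : fsum R G.

Definition fmul x y : fsum R G := fext (fun g => fext (fun h => fU R (g * h)%g) y) x.
Definition fone : fsum R G := fU R 1%g.

Lemma fmulUU (g h : G) : fmul (fU R g) (fU R h) = fU R (g * h)%g.
Proof. by rewrite /fmul !fextU. Qed.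

Let lP c x x' y : fmul (c *: x + x') y = c *: fmul x y + fmul x' y.
Proof. by rewrite /fmul linearP. Qed.
Let l0 y : fmul 0 y = 0. Proof. by rewrite /fmul linear0. Qed.
Let rP c x y y' : fmul x (c *: y + y') = c *: fmul x y + fmul x y'.
Proof.
rewrite /fmul {1}/fext.
under eq_bigr do rewrite linearP scalerDr scalerA mulrC -scalerA.
by rewrite big_split /= -scaler_sumr.
Qed.
Let r0 x : fmul x 0 = 0.
Proof. by rewrite /fmul {1}/fext big1 // => g _; rewrite linear0 scaler0. Qed.

Let ind3 (P : fsum R G -> Prop) : (forall g, P (fU R g)) ->
  (forall c x y, P x -> P y -> P (c *: x + y)) -> P 0 -> forall x, P x.
Proof.
move=> PU PD P0 x; rewrite -[x]fextUid /fext.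
by elim/big_rec: _ => // g y _ Py; apply: PD.
Qed.

Fact fmulA : associative fmul.
Proof.
move=> x y z; elim/ind3: x => [g|c x x' hx hx'|]; first last.
- by rewrite !l0.
- by rewrite !lP hx hx'.
elim/ind3: y => [h|c y y' hy hy'|]; first last.
- by rewrite l0 r0 l0.
- by rewrite !(lP, rP) hy hy'.
elim/ind3: z => [k|c z z' hz hz'|]; first last.
- by rewrite !r0.
- by rewrite !rP hz hz'.
by rewrite !fmulUU mulgA.
Qed.

Fact fmul1l : left_id fone fmul.
Proof.
move=> x; elim/ind3: x => [g|c x x' hx hx'|].
- by rewrite fmulUU mul1g.
- by rewrite rP hx hx'.
- by rewrite r0.
Qed.

Fact fmul1r : right_id fone fmul.
Proof.
move=> x; elim/ind3: x => [g|c x x' hx hx'|].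
- by rewrite fmulUU mulg1.
- by rewrite lP hx hx'.
- by rewrite l0.
Qed.

Fact fmulDl : left_distributive fmul +%R.
Proof. by move=> x y z; rewrite -[x]scale1r lP !scale1r. Qed.
Fact fmulDr : right_distributive fmul +%R.
Proof. by move=> x y z; rewrite -[y]scale1r rP !scale1r. Qed.

Fact fone_neq0 : fone != 0.
Proof.
apply/eqP => /fsumP /(_ 1%g); rewrite fcoefU fcoef0 eqxx => /eqP.
by rewrite oner_eq0.
Qed.

HB.instance Definition _ := GRing.Zmodule_isNzRing.Build (fsum R G)
  fmulA fmul1l fmul1r fmulDl fmulDr fone_neq0.

Fact fscaleAl (c : R) x y : c *: (x * y) = (c *: x) * y.
Proof. by rewrite -[RHS]/(fmul _ _) -[c *: x]addr0 lP l0 addr0. Qed.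
HB.instance Definition _ := GRing.Lmodule_isLalgebra.Build R (fsum R G) fscaleAl.
Fact fscaleAr (c : R) x y : c *: (x * y) = x * (c *: y).
Proof. by rewrite -[RHS]/(fmul _ _) -[c *: y]addr0 rP r0 addr0. Qed.
HB.instance Definition _ := GRing.Lalgebra_isAlgebra.Build R (fsum R G) fscaleAr.

Lemma fU1 : fU R (1%g : G) = 1. Proof. by []. Qed.
Lemma fUM (g h : G) : fU R (g * h)%g = fU R g * fU R h.
Proof. by rewrite -fmulUU. Qed.

Lemma fcoefM x y (k : G) : fcoef (x * y) k =
  \sum_(g <- fsupp x) \sum_(h <- fsupp y) fcoef x g * fcoef y h *+ (k == (g * h)%g).
Proof.
rewrite -[x * y]/(fmul x y) /fmul /fext fcoef_sum; apply: eq_bigr => g _.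
rewrite fcoefZ fcoef_sum mulr_sumr; apply: eq_bigr => h _.
by rewrite fcoefZ fcoefU mulrA mulr_natr.
Qed.

Lemma fsum_ind (P : fsum R G -> Prop) : (forall g, P (fU R g)) ->
  (forall c x y, P x -> P y -> P (c *: x + y)) -> P 0 -> forall x, P x.
Proof. exact: ind3. Qed.

End GroupRing.

(* written multiplicatively; the isomorphism with Z^r is part of the structure *)
HB.mixin Record isFreeAbelian H of Group H := {
  frank : nat;
  fexp : H -> 'rV[int]_frank;
  fexp_bij : bijective fexp;
  fexpM : {morph fexp : x y / (x * y)%g >-> x + y}
}.

#[short(type="freeAbGroupType")]
HB.structure Definition FreeAbelian := {H of isFreeAbelian H & Group H}.

Section FreeAbelianTheory.
Variable H : freeAbGroupType.

Lemma fexp_inj : injective (@fexp H).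
Proof. exact: bij_inj fexp_bij. Qed.

Lemma freeab_mulgC (x y : H) : (x * y = y * x)%g.
Proof. by apply: fexp_inj; rewrite !fexpM addrC. Qed.

End FreeAbelianTheory.

Section LexPositive.
Variable r : nat.
Implicit Types u v w : 'rV[int]_r.

Definition lex_pos v := exists i, 0 < v 0 i /\ forall j : 'I_r, (j < i)%N -> v 0 j = 0.
Local Notation pos := lex_pos.

Let posD u v : pos u -> pos v -> pos (u + v).
Proof.
move=> [i [ui hi]] [j [vj hj]]; case: (ltngtP i j) => [ij|ji|/val_inj ij].
- exists i; rewrite mxE (hj _ ij) addr0; split=> // k ki.
  by rewrite mxE hi // hj ?addr0 // (ltn_trans ki).
- exists j; rewrite mxE (hi _ ji) add0r; split=> // k kj.
  by rewrite mxE hj // hi ?addr0 // (ltn_trans kj).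
- exists i; rewrite mxE; split; first by rewrite addr_gt0 // ij.
  by move=> k ki; rewrite mxE hi // hj ?addr0 // -ij.
Qed.

Let pos0 : ~ pos 0.
Proof. by move=> [i []]; rewrite mxE ltxx. Qed.

Let pos_total v : v != 0 -> pos v \/ pos (- v).
Proof.
move=> /rV0Pn[i0 hi0]; pose P i := v 0 i != 0.
case: (@arg_minnP _ i0 P (fun i => i : nat) hi0) => i vi mini.
have z (j : 'I_r) : (j < i)%N -> v 0 j = 0.
  by move=> ji; apply/eqP; apply: contraLR ji => /mini; rewrite -leqNgt.
have [vp|vn] := ltrP 0 (v 0 i); [left|right]; exists i.
  by split.
split; first by rewrite mxE oppr_gt0 lt_neqAle vn andbT; exact: vi.
by move=> j /z vj; rewrite mxE vj oppr0.
Qed.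

Lemma lex_max (T : eqType) (f : T -> 'rV[int]_r) (s : seq T) : injective f ->
  s != [::] -> exists2 m, m \in s & forall y, y \in s -> y != m -> pos (f m - f y).
Proof.
move=> fI; elim: s => // a s IH _; have [->|/IH[m ms hm]] := eqVneq s [::].
  by exists a => [|y]; rewrite inE // => ->.
have [am|am] := eqVneq a m.
  move: ms hm; rewrite -am => _ hm; exists a => [|y]; first by rewrite mem_head.
  by rewrite inE => /predU1P[->|]; [rewrite eqxx | exact: hm].
have : f a - f m != 0 by rewrite subr_eq0 (inj_eq fI).
move=> /pos_total[h|]; last rewrite opprB => h.
  exists a => [|y]; first by rewrite mem_head.
  rewrite inE => /predU1P[->|ys ya]; first by rewrite eqxx.
  have [->//|ym] := eqVneq y m.
  by rewrite -(subrKA (f m)); apply: posD => //; apply: hm.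
exists m => [|y]; first by rewrite inE ms orbT.
by rewrite inE => /predU1P[->//|]; apply: hm.
Qed.

Lemma lex_max_uniq (T : eqType) (f : T -> 'rV[int]_r) (s t : seq T) m p :
  (forall y, y \in s -> y != m -> pos (f m - f y)) ->
  (forall y, y \in t -> y != p -> pos (f p - f y)) ->
  forall a b, a \in s -> b \in t -> f m + f p = f a + f b -> a = m /\ b = p.
Proof.
move=> hm hp a b sa tb e; have e' : f m - f a = - (f p - f b).
  by rewrite opprB; apply/eqP; rewrite subr_eq addrAC [f b + _]addrC -e addrK.
have [am|am] := eqVneq a m; have [bp|bp] := eqVneq b p => //; exfalso.
- have := hp _ tb bp; have : f p - f b = 0.
    by apply/eqP; rewrite -oppr_eq0 -e' am subrr.
  by move=> -> /pos0.
- by have := hm _ sa am; rewrite e' bp subrr oppr0 => /pos0.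
- by have := posD (hm _ sa am) (hp _ tb bp); rewrite e' addNr => /pos0.
Qed.

End LexPositive.

Section LaurentRing.
Variables (R : comNzRingType) (H : freeAbGroupType).

Fact laurent_mulC : commutative (@GRing.mul (fsum R H)).
Proof.
elim/fsum_ind => [g|c x x' hx hx'|] y; last by rewrite mul0r mulr0.
  elim/fsum_ind: y => [h|c y y' hy hy'|]; last by rewrite mul0r mulr0.
    by rewrite -!fUM freeab_mulgC.
  by rewrite mulrDr mulrDl -scalerAr -scalerAl hy hy'.
by rewrite mulrDr mulrDl -scalerAr -scalerAl hx hx'.
Qed.

HB.instance Definition _ :=
  GRing.PzRing_hasCommutativeMul.Build (fsum R H) laurent_mulC.

Definition laurent_unit : pred (fsum R H) := fun x => `[< exists y, y * x = 1 >].
Definition laurent_inv (x : fsum R H) : fsum R H :=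
  if pselect (exists y, y * x = 1) is left h then projT1 (cid h) else x.

Fact laurent_mulVx : {in laurent_unit, left_inverse 1 laurent_inv *%R}.
Proof.
move=> x /asboolP h; rewrite /laurent_inv; case: pselect => // h'.
by case: (cid h').
Qed.
Fact laurent_unitPl (x y : fsum R H) : y * x = 1 -> laurent_unit x.
Proof. by move=> yx; apply/asboolP; exists y. Qed.
Fact laurent_invx_out : {in [predC laurent_unit], laurent_inv =1 id}.
Proof.
move=> x; rewrite inE => /asboolPn h.
by rewrite /laurent_inv; case: pselect.
Qed.

HB.instance Definition _ := GRing.ComNzRing_hasMulInverse.Build (fsum R H)
  laurent_mulVx laurent_unitPl laurent_invx_out.

End LaurentRing.

Section LaurentDomain.
Variables (R : idomainType) (H : freeAbGroupType).

Fact laurent_domain : GRing.integral_domain_axiom (fsum R H).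
Proof.
move=> x y xy0; apply/norP => -[x0 y0].
have ne (z : fsum R H) : z != 0 -> (fsupp z : seq H) != [::].
  move=> /fsum_neq0[k kz]; apply/eqP => z0.
  by have : k \in (fsupp z : seq H) by []; rewrite z0.
have [m sm hm] := lex_max (@fexp_inj H) (ne _ x0).
have [p sp hp] := lex_max (@fexp_inj H) (ne _ y0).
have key := lex_max_uniq hm hp.
move/fsumP: xy0 => /(_ (m * p)%g); rewrite fcoef0 fcoefM.
rewrite (big_fsetD1 m sm) /= (big_fsetD1 p sp) /= eqxx.
rewrite big1_seq ?addr0; last first.
  move=> h; rewrite in_fsetD1 => /and3P[_ hp' hs]; case: eqP => // e.
  have [|_ /eqP] := key m h sm hs; first by rewrite -!fexpM e.
  by rewrite (negPf hp').
rewrite big1_seq ?addr0; last first.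
  move=> g; rewrite in_fsetD1 => /and3P[_ gm gs].
  rewrite big1_seq // => h /= hs; case: eqP => // e.
  have [|/eqP] := key g h gs hs; first by rewrite -!fexpM e.
  by rewrite (negPf gm).
by move/eqP; rewrite mulf_eq0; rewrite !fsuppE in sm sp; rewrite (negPf sm) (negPf sp).
Qed.

HB.instance Definition _ :=
  GRing.ComUnitRing_isIntegral.Build (fsum R H) laurent_domain.

End LaurentDomain.

Definition divides (A : comNzRingType) (d x : A) := exists q, x = q * d.

(* in particular the GCD of the empty family is 0 *)
Definition is_gcd (A : comNzRingType) (S : A -> Prop) (d : A) :=
  (forall x, S x -> divides d x) /\
  (forall c, (forall x, S x -> divides c x) -> divides c d).

Definition irreducible (R : idomainType) (x : R) :=
  [/\ x != 0, x \isn't a GRing.unit &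
      forall a b, x = a * b -> a \is a GRing.unit \/ b \is a GRing.unit].

Definition associated (R : idomainType) (x y : R) :=
  exists2 u, u \is a GRing.unit & y = u * x.

Definition factorial_ring (R : idomainType) :=
  (forall x : R, x != 0 -> x \isn't a GRing.unit ->
     exists2 s : seq R, {in s, forall p, irreducible p} & x = \prod_(p <- s) p) /\
  (forall s t : seq R,
     {in s, forall p, irreducible p} -> {in t, forall p, irreducible p} ->
     \prod_(p <- s) p = \prod_(p <- t) p ->
     exists t', [/\ perm_eq t t', size s = size t' &
       forall i, (i < size s)%N -> associated s`_i t'`_i]).

Definition is_minor (A : comNzRingType) k p q (M : 'M[A]_(p, q)) (d : A) :=
  exists (f : 'I_k -> 'I_p) (g : 'I_k -> 'I_q),
    [/\ {homo f : i j / (i < j)%N}, {homo g : i j / (i < j)%N} &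
        d = \det (mxsub f g M)].

Record module_basis (R : comNzRingType) (V : lmodType R) (n : nat) := Basis {
  bvec :> 'I_n -> V;
  bcoord : V -> 'rV[R]_n;
  bvecK : forall v, \sum_i bcoord v 0 i *: bvec i = v;
  bcoordK : forall c : 'rV[R]_n, bcoord (\sum_i c 0 i *: bvec i) = c
}.

Definition right_representation (G : groupType) (R : comNzRingType)
    (V : lmodType R) (rho : G -> {linear V -> V}) :=
  (forall g, bijective (rho g)) /\
  (forall a b v, rho (a * b)%g v = rho b (rho a v)).

(* (i, false) is the generator x_i and (i, true) its inverse *)
Definition letter (s : nat) : Type := 'I_s * bool.
Definition word (s : nat) : Type := seq (letter s).

Section Presentation.
Variables (G : groupType) (s : nat) (g : 'I_s -> G).

Definition letter_val (a : letter s) : G := if a.2 then (g a.1)^-1%g else g a.1.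

Definition word_val (w : word s) : G :=
  foldr (fun a x => letter_val a * x)%g 1%g w.

(* equality of words in the group <x_1, .., x_s | r_1, .., r_l> *)
Inductive word_eqv (l : nat) (r : 'I_l -> word s) : word s -> word s -> Prop :=
| WRefl w : word_eqv r w w
| WSym w w' : word_eqv r w w' -> word_eqv r w' w
| WTrans w w' w'' : word_eqv r w w' -> word_eqv r w' w'' -> word_eqv r w w''
| WCancel u v i b : word_eqv r (u ++ [:: (i, b); (i, ~~ b)] ++ v) (u ++ v)
| WRelator u v k : word_eqv r (u ++ r k ++ v) (u ++ v).

Definition presents (l : nat) (r : 'I_l -> word s) :=
  (forall x, exists w, word_val w = x) /\
  (forall w w', word_val w = word_val w' <-> word_eqv r w w').

(* The image in Z[G] of the Fox derivative with respect to x_j: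
   d(x_i) = delta_ij, d(x_i^-1) = - delta_ij x_i^-1, d(uv) = d(u) + u d(v). *)
Definition fox_letter (j : 'I_s) (a : letter s) : fsum int G :=
  if a.1 == j then if a.2 then - fU int (g a.1)^-1%g else 1 else 0.

Fixpoint fox (j : 'I_s) (w : word s) : fsum int G :=
  if w is a :: w' then fox_letter j a + fU int (letter_val a) * fox j w' else 0.

Definition alexander_mx (l : nat) (r : 'I_l -> word s) : 'M[fsum int G]_(l, s) :=
  \matrix_(i, j) fox j (r i).

End Presentation.

Section Invariants.
Variables (G : groupType) (R : idomainType) (V : lmodType R) (n : nat).
Variables (e : module_basis V n) (rho : G -> {linear V -> V}).
Variables (H : freeAbGroupType) (pi : G -> H).

Local Notation Lambda := (fsum R H).

(* VH = Lambda (x)_R V: the row (c_1, .., c_n) is \sum_k c_k (x) e_k *)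
Local Notation VH := 'rV[Lambda]_n.

Definition tens (lam : Lambda) (v : V) : VH :=
  \row_k (bcoord e v 0 k *: lam).

Definition rho_pi (g : G) (w : VH) : VH :=
  \sum_k tens (fU R (pi g) * w 0 k) (rho g (e k)).

(* the right action of Z[G] extending v . g = rho_pi g v *)
Definition ract (w : VH) (a : fsum int G) : VH :=
  \sum_(g <- fsupp a) rho_pi g w *~ fcoef a g.

(* [psi (g) = pi(g) rhobar(g)], extended additively to Z[G] *)
Definition rhobar (g : G) : 'M[R]_n := \matrix_(i, j) bcoord e (rho g (e i)) 0 j.

Definition psi (a : fsum int G) : 'M[Lambda]_n :=
  \sum_(g <- fsupp a)
    (\matrix_(i, j) (rhobar g i j *: fU R (pi g))) *~ fcoef a g.

Variables (s l : nat) (g : 'I_s -> G) (r : 'I_l -> word s).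

(* [id (x) d_2], after identifying VH (x)_{Z[G]} Z[G]^m with VH^m through
   w (x) a e_j = w . a (x) e_j *)
Definition id_tens_d2 (w : 'I_l -> VH) (j : 'I_s) : VH :=
  \sum_i ract (w i) (alexander_mx g r i j).

(* the matrix of [id (x) d_2] in the bases (1 (x) e_k) (x) f_i of the source and
   (1 (x) e_k) (x) e_j of the target; the rows are the images of the basis *)
Definition d2_mx :=
  \mxblock_(i < l, j < s) \matrix_(k < n, k' < n)
    (id_tens_d2 (fun i' => if i' == i then tens 1 (e k) else 0) j 0 k' : Lambda).

Definition is_fitting_invariant (A : Lambda) :=
  is_gcd (is_minor (n * s.-1) d2_mx) A.

Definition psi_mx p q (M : 'M[fsum int G]_(p, q)) :=
  \mxblock_(i < p, j < q) psi (M i j).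

Definition is_twisted_alexander (Delta : {fraction Lambda}) :=
  exists (j : 'I_s) (Q : Lambda),
    [/\ \det (psi (1 - fU int (g j))) != 0,
        is_gcd (is_minor (n * s.-1) (psi_mx (col' j (alexander_mx g r)))) Q &
        Delta = tofrac Q / tofrac (\det (psi (1 - fU int (g j))))].

End Invariants.

Section TensorProduct.
Variables (G : groupType) (R : idomainType) (V : lmodType R) (n : nat).
Variables (e : module_basis V n) (rho : G -> {linear V -> V}).
Variables (H : freeAbGroupType) (pi : G -> H).

Lemma bcoord_linear : linear (bcoord e).
Proof.
move=> a u v; rewrite -[RHS](bcoordK e) -{1}(bvecK e u) -{1}(bvecK e v).
congr bcoord; rewrite scaler_sumr -big_split; apply: eq_bigr => i _ /=.
by rewrite !mxE scalerDl scalerA.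
Qed.
HB.instance Definition _ :=
  GRing.isLinear.Build R V 'rV[R]_n _ (bcoord e) bcoord_linear.

Lemma tensDl (a b : fsum R H) v : tens e (a + b) v = tens e a v + tens e b v.
Proof. by apply/rowP => k; rewrite !mxE scalerDr. Qed.

Lemma tensDr (a : fsum R H) u v : tens e a (u + v) = tens e a u + tens e a v.
Proof. by apply/rowP => k; rewrite !mxE [bcoord e (_ + _)]linearD mxE scalerDl. Qed.

Lemma tensZ (a b : fsum R H) v : tens e (a * b) v = a *: tens e b v.
Proof. by apply/rowP => k; rewrite !mxE scalerAr. Qed.

Lemma tens_balanced (c : R) (a : fsum R H) v : tens e (c *: a) v = tens e a (c *: v).
Proof. by apply/rowP => k; rewrite !mxE [bcoord e (_ *: _)]linearZ mxE scalerA mulrC. Qed.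

Lemma VH_sum_tens (w : 'rV[fsum R H]_n) : w = \sum_k tens e (w 0 k) (e k).
Proof.
have cE k : bcoord e (e k) = delta_mx 0 k.
  rewrite -(bcoordK e (delta_mx 0 k)); congr bcoord.
  rewrite (bigD1 k) //= mxE !eqxx scale1r big1 ?addr0 // => i ik.
  by rewrite mxE eqxx (negPf ik) scale0r.
apply/rowP => i; rewrite summxE (bigD1 i) //= mxE cE mxE !eqxx scale1r.
rewrite big1 ?addr0 // => k ki.
by rewrite mxE cE mxE eqxx eq_sym (negPf ki) scale0r.
Qed.

Lemma rho_pi_tens g (a : fsum R H) v :
  rho_pi e rho pi g (tens e a v) = tens e (fU R (pi g) * a) (rho g v).
Proof.
have t0 b : tens e (b : fsum R H) 0 = 0.
  by apply/rowP => k; rewrite !mxE [bcoord e 0]linear0 mxE scale0r.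
rewrite -{2}(bvecK e v) linear_sum (big_morph _ (tensDr _) (t0 _)) /rho_pi.
by apply: eq_bigr => k _; rewrite mxE -scalerAr tens_balanced linearZ.
Qed.

(* VH with [tens] has the universal property of the extension of scalars of V *)
Lemma tens_universal (W : lmodType (fsum R H)) (f : V -> W) :
  (forall u v, f (u + v) = f u + f v) -> (forall c v, f (c *: v) = c%:A *: f v) ->
  exists F : {linear 'rV[fsum R H]_n -> W},
    (forall v, F (tens e 1 v) = f v) /\
    (forall F' : {linear 'rV[fsum R H]_n -> W}, (forall v, F' (tens e 1 v) = f v) -> F' =1 F).
Proof.
move=> fD fZ; pose F (w : 'rV[fsum R H]_n) : W := \sum_k w 0 k *: f (e k).
have FP : linear F.
  move=> a w w'; rewrite /F scaler_sumr -big_split; apply: eq_bigr => k _ /=.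
  by rewrite !mxE scalerDl scalerA.
pose FL := GRing.isLinear.Build _ _ _ _ F FP.
pose F1 : {linear 'rV[fsum R H]_n -> W} := HB.pack F FL.
exists F1; split => [v|F' hF' w].
  have f0 : f 0 = 0 by rewrite -(scale0r 0) fZ !scale0r.
  rewrite -{2}(bvecK e v) (big_morph f fD f0).
  by apply: eq_bigr => k _; rewrite mxE fZ.
rewrite {1}[w]VH_sum_tens linear_sum; apply: eq_bigr => k _.
by rewrite -[w 0 k in LHS]mulr1 tensZ linearZ hF'.
Qed.

End TensorProduct.

Section Localisation.
Variables (R : idomainType) (H : freeAbGroupType) (RR : realType) (xi : H -> RR).

(* for a = 0 this is a monomial with invertible coefficient *)
Definition xi_monic (x : fsum R H) :=
  exists a (c : 'I_a.+1 -> R) (h : 'I_a.+1 -> H),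
    [/\ c ord0 \is a GRing.unit, c ord_max \is a GRing.unit,
        forall i, i != ord0 -> xi (h ord0) < xi (h i),
        forall i, i != ord_max -> xi (h i) < xi (h ord_max) &
        x = \sum_i c i *: fU R (h i)].

Definition in_localisation (u : {fraction (fsum R H)}) :=
  exists a b, xi_monic b /\ u = tofrac a / tofrac b.

Definition localisation_unit (u : {fraction (fsum R H)}) :=
  in_localisation u /\ exists2 v, in_localisation v & u * v = 1.

End Localisation.

Local Open Scope classical_set_scope.

Section Manifold.
Variable RR : realType.
Local Notation E := 'rV[RR]_3.

Fixpoint Ck (k : nat) (U : set E) (f : E -> RR) : Prop :=
  (forall x, U x -> {for x, continuous f}) /\
  if k is k'.+1 then
    forall i : 'I_3, (forall x, U x -> derivable f x (delta_mx 0 i)) /\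
      Ck k' U (fun x => 'D_(delta_mx 0 i) f x)
  else True.

(* smoothness on an arbitrary subset A: local smooth extensions exist *)
Definition smooth_on (A : set E) (f : E -> E) := forall x, A x ->
  exists (U : set E) (F : E -> E), [/\ open U, U x,
    forall (k : nat) (i : 'I_3), Ck k U (fun y => F y 0 i) &
    forall y, A y -> U y -> F y = f y].

Definition half_space : set E := [set x | 0 <= x 0 0].

Variable M : topologicalType.

Record chart := Chart { dom : set M; toE : M -> E; ofE : E -> M }.

(* a homeomorphism from an open set of M to a relatively open set of the half-space *)
Definition is_chart (c : chart) :=
  [/\ open (dom c),
      exists2 O : set E, open O & toE c @` dom c = O `&` half_space,
      forall x, dom c x -> ofE c (toE c x) = x,
      {within dom c, continuous (toE c)} &
      {within toE c @` dom c, continuous (ofE c)}].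

Definition is_smooth_atlas (A : set chart) :=
  [/\ forall c, A c -> is_chart c,
      forall x, exists2 c, A c & dom c x &
      forall c c', A c -> A c' ->
        smooth_on (toE c @` (dom c `&` dom c')) (toE c' \o ofE c)].

Definition smooth_3manifold_with_boundary :=
  [/\ hausdorff_space M, @second_countable M & exists A, is_smooth_atlas A].

Variable x0 : M.

Definition is_loop (p : RR -> M) :=
  [/\ {within `[0, 1], continuous p}, p 0 = x0 & p 1 = x0].

Definition loop_homotopic (p q : RR -> M) := exists F : RR * RR -> M,
  [/\ {within `[0, 1] `*` `[0, 1], continuous F},
      forall t, t \in `[0, 1] -> F (t, 0) = p t,
      forall t, t \in `[0, 1] -> F (t, 1) = q t &
      forall u, u \in `[0, 1] -> F (0, u) = x0 /\ F (1, u) = x0].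

Definition loop_concat (p q : RR -> M) : RR -> M :=
  fun t => if t <= 2^-1 then p (2 * t) else q (2 * t - 1).

(* cls identifies G with the loops at x0 up to homotopy *)
Definition is_fundamental_group (G : groupType) := exists cls : (RR -> M) -> G,
  [/\ forall x, exists2 p, is_loop p & cls p = x,
      forall p q, is_loop p -> is_loop q -> (cls p = cls q <-> loop_homotopic p q) &
      forall p q, is_loop p -> is_loop q ->
        cls (loop_concat p q) = (cls p * cls q)%g].

Definition simplex k : set 'rV[RR]_k.+1 :=
  [set t | (forall i, 0 <= t 0 i) /\ \sum_i t 0 i = 1].
Arguments simplex : clear implicits.

(* A singular simplex is a continuous map on [simplex k]; to make equality of
   functions the equality of such maps, its value elsewhere is fixed to be x0. *)
Definition singular k (sg : 'rV[RR]_k.+1 -> M) :=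
  {within simplex k, continuous sg} /\ forall t, ~ simplex k t -> sg t = x0.

Definition coface k (i : 'I_k.+2) (t : 'rV[RR]_k.+1) : 'rV[RR]_k.+2 :=
  \row_j (if unlift i j is Some j' then t 0 j' else 0).

Definition face k (i : 'I_k.+2) (sg : 'rV[RR]_k.+2 -> M) : 'rV[RR]_k.+1 -> M :=
  patch (fun=> x0) (simplex k) (sg \o coface i).

Definition chain k (c : fsum rat ('rV[RR]_k.+1 -> M)) :=
  forall sg, sg \in fsupp c -> singular sg.

Definition boundary k :
    fsum rat ('rV[RR]_k.+2 -> M) -> fsum rat ('rV[RR]_k.+1 -> M) :=
  fext (fun sg => \sum_(i < k.+2) (-1) ^+ i *: fU rat (face i sg)).

Definition is_cycle k : fsum rat ('rV[RR]_k.+1 -> M) -> Prop :=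
  if k is k'.+1 then fun c => chain c /\ boundary c = 0 else fun c => chain c.

(* H_k(M; Q) has a basis of b elements *)
Definition betti_number (k b : nat) :=
  exists z : 'I_b -> fsum rat ('rV[RR]_k.+1 -> M),
    (forall i, is_cycle (z i)) /\
    forall c, is_cycle c -> exists! a : 'rV[rat]_b,
      exists2 w, chain w & c = \sum_i a 0 i *: z i + boundary w.

Definition euler_characteristic (chi : int) := exists (N : nat) (b : nat -> nat),
  [/\ forall k, betti_number k (b k), forall k, (N <= k)%N -> b k = 0%N &
      chi = \sum_(k < N) (-1) ^+ k * (b k)%:Z].

End Manifold.

(* Main.v *)
Require Import Defs.
From HB Require Import structures.
From mathcomp Require Import all_boot all_order all_algebra fraction.
From mathcomp Require Import perm ring.
From mathcomp Require Import boolp classical_sets reals topology.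

Set Implicit Arguments.
Unset Strict Implicit.
Unset Printing Implicit Defensive.

Import Order.TTheory GRing.Theory Num.Theory.
Local Open Scope ring_scope.

(** The equality comes from linear algebra over the ring Lambda = R[H].

   Let N be the matrix psi(Alexander matrix), with n(s-1) of its rows selected,
   let B be the column of blocks psi(1 - g_i), and let D = det psi(1 - g_j).
   Fox's fundamental formula gives N B = 0.  Stack n further rows S on top of N,
   and multiply the square matrix [S; N] by the square matrix formed of B and of
   the unit columns of the blocks other than the j-th.  The product is block
   triangular, and so, up to sign ([complementary_minors]),
     det [S; N] * D = det (S B) * det (N without its j-th block).
   This identity is used for two choices of S.
   - If S selects the columns complementary to g, then det [S; N] is up to sign
     the minor of N on the columns g.  Hence Q divides D times every minor of
     the Alexander matrix, and Q divides A * D, say A * D = u * Q.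
   - If S is the row of the blocks psi(dx/dg_i), then S B = psi(1 - x), again by
     Fox's formula.  Expanding det [S; N] along S shows that A divides it, hence
     A * D divides det psi(1 - x) * Q, and u divides det psi(1 - x), by
     cancelling Q (if Q = 0, then A = 0, and u = 1 does).
   So A = u * Delta, where u divides det psi(1 - x) for every x in G.  Up to a
   monomial, this determinant is the characteristic polynomial of rhobar(x)
   evaluated at pi(x)^-1.  Its two extreme coefficients are units, so for
   xi(pi(x)) <> 0 it is xi-monic, and u becomes invertible in the localisation.

   Both divisibility statements move a factor into a gcd: if z divides c * y for
   all y in a set, it divides c times the gcd of the set ([is_gcd_mul]).  This
   holds in domains where any two elements have a gcd.  That Lambda is such a
   domain follows from the factoriality of R: by Gauss's lemma the property passes
   to polynomial rings, and Laurent polynomials are a localisation of these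
   ([laurent_gcd_domain]). *)

(** * GCD domains *)

Section Divisibility.
Variable A : idomainType.
Implicit Types a b c d x y : A.

Lemma dividesxx x : divides x x.
Proof. by exists 1; rewrite mul1r. Qed.

Lemma divides0 d : divides d (0 : A).
Proof. by exists 0; rewrite mul0r. Qed.

Lemma divides_mull d x y : divides d y -> divides d (x * y).
Proof. by move=> [q ->]; exists (x * q); rewrite mulrA. Qed.

Lemma divides_mulr d x y : divides d x -> divides d (x * y).
Proof. by rewrite mulrC; apply: divides_mull. Qed.

Lemma divides_trans x y z : divides x y -> divides y z -> divides x z.
Proof. by move=> xy [q ->]; apply: divides_mull. Qed.

Lemma dividesD d x y : divides d x -> divides d y -> divides d (x + y).
Proof. by move=> [q ->] [q' ->]; exists (q + q'); rewrite mulrDl. Qed.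

Lemma dividesB d x y : divides d x -> divides d y -> divides d (x - y).
Proof. by move=> [q ->] [q' ->]; exists (q - q'); rewrite mulrBl. Qed.

Lemma divides_sum (I : Type) (s : seq I) (P : pred I) (F : I -> A) d :
  (forall i, P i -> divides d (F i)) -> divides d (\sum_(i <- s | P i) F i).
Proof. by move=> dF; elim/big_ind: _ => // [|x y]; [exact: divides0 | exact: dividesD]. Qed.

Lemma divides_mul2l c x y : c != 0 -> divides (c * x) (c * y) <-> divides x y.
Proof.
move=> c0; split=> -[q e]; exists q; last by rewrite e mulrCA.
by apply: (mulfI c0); rewrite e mulrCA.
Qed.

Lemma divides0P x : divides 0 x -> x = 0.
Proof. by move=> [q ->]; rewrite mulr0. Qed.

Lemma divides_sign k d x : divides d ((-1) ^+ k * x) <-> divides d x.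
Proof.
split; last exact: divides_mull.
by move/(divides_mull ((-1) ^+ k)); rewrite mulrA -expr2 sqrr_sign mul1r.
Qed.

End Divisibility.

Definition pair_set (A : comNzRingType) (a b x : A) := x = a \/ x = b.

Definition gcd_domain (A : idomainType) :=
  forall a b : A, exists d, is_gcd (pair_set a b) d.

Section GcdDomain.
Variable A : idomainType.
Implicit Types a b c d x y : A.

Lemma is_gcd_pair a b d :
  is_gcd (pair_set a b) d <->
  [/\ divides d a, divides d b &
      forall c, divides c a -> divides c b -> divides c d].
Proof.
split=> [[da dm]|[da db dm]].
  split; [by apply: da; left | by apply: da; right |].
  by move=> c ca cb; apply: dm => x [->|->].
split=> [x [->|->] //|c h].
by apply: dm; apply: h; [left | right].
Qed.

Hypothesis gcdA : gcd_domain A.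

Lemma is_gcd_pairM c a b d :
  is_gcd (pair_set a b) d -> is_gcd (pair_set (c * a) (c * b)) (c * d).
Proof.
move=> /is_gcd_pair[da db dm]; apply/is_gcd_pair.
have [->|c0] := eqVneq c 0; first by rewrite !mul0r; split=> //; exact: divides0.
split; [exact/divides_mul2l | exact/divides_mul2l |] => x xa xb.
have [e /is_gcd_pair[ea eb em]] := gcdA (c * a) (c * b).
apply: divides_trans (em _ xa xb) _.
have [e' ee'] : divides c e by apply: em; apply: divides_mulr; exact: dividesxx.
move: ea eb; rewrite ee' mulrC => /(divides_mul2l _ _ c0) ea /(divides_mul2l _ _ c0) eb.
by apply/(divides_mul2l _ _ c0); apply: dm.
Qed.

(** Euclid's lemma: c is the gcd of a * c and b * c, and a divides both. *)
Lemma coprime_divides a b c :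
  is_gcd (pair_set a b) 1 -> divides a (b * c) -> divides a c.
Proof.
move=> /(is_gcd_pairM c) /is_gcd_pair[_ _]; rewrite mulr1 => h ab.
by apply: h; [apply: divides_mull; exact: dividesxx | rewrite mulrC].
Qed.

Lemma gcd_cofactors a b d : d != 0 -> is_gcd (pair_set a b) d ->
  exists a' b', [/\ a = d * a', b = d * b' & is_gcd (pair_set a' b') 1].
Proof.
move=> d0 /is_gcd_pair[[a' ea] [b' eb] dm]; exists a', b'.
split; rewrite 1?mulrC //; apply/is_gcd_pair; split=> [||c ca cb].
- by exists a'; rewrite mulr1.
- by exists b'; rewrite mulr1.
apply/(divides_mul2l _ _ d0); rewrite mulr1.
by apply: dm; rewrite ?ea ?eb [_ * d]mulrC; apply/divides_mul2l.
Qed.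

(** Cancelling the gcd of x and c leaves coprime elements x' and c', and Euclid's
   lemma makes x' divide all of S.  Only gcds of pairs are formed, so that S can be
   any set that has a gcd. *)
Lemma is_gcd_mul S d c x : is_gcd S d ->
  (forall y, S y -> divides x (c * y)) -> divides x (c * d).
Proof.
move=> [dS dm] xS; have [e he] := gcdA x c.
have [e0|e0] := eqVneq e 0.
  move: he; rewrite e0 => /is_gcd_pair[_ /divides0P -> _].
  by rewrite mul0r; exact: divides0.
have [x' [c' [ex ec co]]] := gcd_cofactors e0 he.
move: xS; rewrite ex ec => xS.
rewrite -mulrA; apply/(divides_mul2l _ _ e0); apply: divides_mull.
apply: dm => y Sy; apply: (coprime_divides co).
by apply/(divides_mul2l _ _ e0); rewrite mulrA; exact: xS.
Qed.

End GcdDomain.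

(** * Factorial rings and polynomial rings are GCD domains *)

Section Factorial.
Variables (R : idomainType) (R_factorial : factorial_ring R).
Implicit Types a b p x : R.

Lemma irreducible_unitM u p : u \is a GRing.unit -> irreducible p -> irreducible (u * p).
Proof.
move=> uu [p0 pu pI]; split.
- by rewrite mulf_neq0 //; apply: contraTneq uu => ->; rewrite unitr0.
- by rewrite unitrM uu.
move=> a b e; have := pI (u^-1 * a) b.
by rewrite -mulrA -e mulKr // unitrM unitrV uu; apply.
Qed.

Lemma divides_prod_mem (s : seq R) x : x \in s -> divides x (\prod_(y <- s) y).
Proof. by move=> xs; rewrite (big_rem x) //=; apply: divides_mulr; exact: dividesxx. Qed.

(** Comparing the factorisation of a * b with the one of its multiple of p
   locates an associate of p among the factors of a or of b. *)
Lemma irreducible_prime p a b :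
  irreducible p -> divides p (a * b) -> divides p a \/ divides p b.
Proof.
move=> irr [q e]; have [p0 pu pI] := irr.
have [a0|a0] := eqVneq a 0; first by left; rewrite a0; exact: divides0.
have [b0|b0] := eqVneq b 0; first by right; rewrite b0; exact: divides0.
have [au|au] := boolP (a \is a GRing.unit).
  by right; exists (a^-1 * q); rewrite -mulrA -e mulKr.
have [bu|bu] := boolP (b \is a GRing.unit).
  by left; exists (b^-1 * q); rewrite -mulrA -e mulrC mulrK.
have q0 : q != 0 by apply: contraNneq (mulf_neq0 a0 b0) => q0; rewrite e q0 mul0r.
have [fac uniqf] := R_factorial.
have [sa ia ea] := fac a a0 au; have [sb ib eb] := fac b b0 bu.
have isab : {in sa ++ sb, forall x, irreducible x}.
  by move=> x; rewrite mem_cat => /orP[/ia|/ib].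
have [p' [t [p'I tI pp' et]]] : exists p' t, [/\ irreducible p',
    {in t, forall x, irreducible x}, divides p p' & a * b = \prod_(x <- p' :: t) x].
  have [qu|qu] := boolP (q \is a GRing.unit).
    exists (q * p), [::]; rewrite big_seq1; split=> //.
      exact: irreducible_unitM.
    by exists q.
  have [sq iq eq] := fac q q0 qu.
  exists p, sq; rewrite big_cons; split=> //; first exact: dividesxx.
  by rewrite e eq mulrC.
have ipt : {in p' :: t, forall x, irreducible x}.
  by move=> x; rewrite inE => /predU1P[->|/tI].
have [|t' [pt' szt' at']] := uniqf _ _ ipt isab.
  by rewrite -et big_cat /= ea eb.
have [u _ eu] := at' 0%N isT.
have mt' : t'`_0 \in sa ++ sb by rewrite (perm_mem pt') mem_nth // -szt'.
have pt0 : divides p t'`_0 by rewrite eu; apply: divides_mull.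
move: mt'; rewrite mem_cat => /orP[/divides_prod_mem h|/divides_prod_mem h].
  by left; rewrite ea; apply: divides_trans h.
by right; rewrite eb; apply: divides_trans h.
Qed.

Lemma divides_irreducibleM p a c : irreducible p -> divides c (p * a) ->
  ~ divides p c -> divides c a.
Proof.
move=> irr [q e] npc; have [p0 _ _] := irr.
have : divides p (q * c) by rewrite -e; apply: divides_mulr; exact: dividesxx.
case/(irreducible_prime irr) => // -[q' eq]; exists q'.
by apply: (mulfI p0); rewrite e eq; ring.
Qed.

(** Induction on the irreducible factors p of the first argument: either p also
   divides b and is a common factor, or p is invisible to the common divisors. *)
Lemma factorial_gcd_domain : gcd_domain R.
Proof.
have [fac _] := R_factorial.
have gcdP (s : seq R) : {in s, forall p, irreducible p} ->
    forall b, exists d, is_gcd (pair_set (\prod_(p <- s) p) b) d.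
  elim: s => [_ b|p s IH irr b].
    exists 1; apply/is_gcd_pair; rewrite big_nil; split=> //; first exact: dividesxx.
    by exists b; rewrite mulr1.
  have irrs : {in s, forall p, irreducible p}.
    by move=> x xs; apply: irr; rewrite inE xs orbT.
  have irrp : irreducible p by apply: irr; rewrite mem_head.
  have [p0 _ _] := irrp; rewrite big_cons.
  have [[b' ->]|npb] := EM (divides p b).
    have [d /is_gcd_pair[da db dm]] := IH irrs b'; exists (p * d); apply/is_gcd_pair.
    rewrite [b' * p]mulrC; split; [exact/divides_mul2l | exact/divides_mul2l |] => c ca cb.
    have [[c' ec]|npc] := EM (divides p c); last first.
      by apply: divides_mull; apply: dm; apply: (divides_irreducibleM irrp).
    move: ca cb; rewrite ec [c' * p]mulrC.
    move=> /(divides_mul2l _ _ p0) ca /(divides_mul2l _ _ p0) cb.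
    by apply/(divides_mul2l _ _ p0); apply: dm.
  have [d /is_gcd_pair[da db dm]] := IH irrs b; exists d; apply/is_gcd_pair.
  split=> //; first exact: divides_mull.
  move=> c ca cb; apply: dm => //; apply: (divides_irreducibleM irrp ca) => pc.
  exact: npb (divides_trans pc cb).
move=> a b; have [->|a0] := eqVneq a 0.
  exists b; apply/is_gcd_pair; split=> //; [exact: divides0 | exact: dividesxx].
have [au|au] := boolP (a \is a GRing.unit).
  exists a; apply/is_gcd_pair; split=> //; first exact: dividesxx.
  by exists (b / a); rewrite divrK.
by have [s si ->] := fac a a0 au; exact: gcdP.
Qed.

End Factorial.

Section PolyGcd.
Variables (A : idomainType) (gcdA : gcd_domain A).
Implicit Types (a b c d : A) (f g h p q : {poly A}).

Definition coef_set f (x : A) := exists i, x = f`_i.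

Definition primitive f := is_gcd (coef_set f) 1.

Lemma divides_polyC c f : divides c%:P f <-> forall i, divides c f`_i.
Proof.
split=> [[q ->] i|h]; first by rewrite coefMC; apply: divides_mull; exact: dividesxx.
elim/poly_ind: f h => [|f a IH] h; first exact: divides0.
apply: dividesD.
  apply: divides_mulr; apply: IH => i.
  by have := h i.+1; rewrite coefD coefMX coefC addr0.
have [q ea] : divides c a by have := h 0%N; rewrite coefD coefMX coefC add0r.
by exists q%:P; rewrite ea polyCM.
Qed.

Lemma content_exists f : exists d, is_gcd (coef_set f) d.
Proof.
elim/poly_ind: f => [|f a [d [df dm]]].
  by exists 0; split=> [x [i ->]|c _]; rewrite ?coef0; exact: divides0.
have [e /is_gcd_pair[ed ea em]] := gcdA d a.
exists e; split=> [x [[|i] ->]|c h].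
- by rewrite coefD coefMX coefC add0r.
- rewrite coefD coefMX coefC addr0 /=; apply: divides_trans ed _.
  by apply: df; exists i.
apply: em; last by apply: h; exists 0%N; rewrite coefD coefMX coefC add0r.
by apply: dm => x [i ->]; apply: h; exists i.+1; rewrite coefD coefMX coefC addr0.
Qed.

Lemma primitive_part f : f != 0 ->
  exists c f1, [/\ c != 0, f = c%:P * f1 & primitive f1].
Proof.
move=> f0; have [c [cf cm]] := content_exists f.
have [f1 e] : divides c%:P f by apply/divides_polyC => i; apply: cf; exists i.
rewrite mulrC in e.
have c0 : c != 0 by apply: contraNneq f0 => c0; rewrite e c0 mul0r.
exists c, f1; split=> //; split=> [x [i ->]|d h]; first by exists f1`_i; rewrite mulr1.
apply/(divides_mul2l _ _ c0); rewrite mulr1; apply: cm => x [i ->].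
by rewrite e coefCM; apply/(divides_mul2l _ _ c0); apply: h; exists i.
Qed.

Lemma primitive_unit f c : primitive f -> divides c%:P f -> divides c 1.
Proof. by move=> [_ fm] /divides_polyC h; apply: fm => x [i ->]. Qed.

Lemma primitiveP f : (forall c, divides c%:P f -> divides c 1) -> primitive f.
Proof.
move=> h; split=> [x [i ->]|c hc]; first by exists f`_i; rewrite mulr1.
by apply: h; apply/divides_polyC => i; apply: hc; exists i.
Qed.

Lemma primitive_neq0 f : primitive f -> f != 0.
Proof.
move=> pf; apply/eqP => f0.
have /divides0P/eqP : divides (0 : A) 1.
  by apply: (primitive_unit pf); rewrite f0; exact: divides0.
by rewrite oner_eq0.
Qed.

Lemma primitive_divisor f g : primitive f -> divides g f -> primitive g.
Proof.
move=> pf gf; apply: primitiveP => c cg.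
by apply: (primitive_unit pf); exact: divides_trans gf.
Qed.

(** c is the gcd of the coefficients of c * f, as 1 is the gcd of those of f. *)
Lemma divides_polyC_primitive a c f : primitive f ->
  divides a%:P (c%:P * f) -> divides a c.
Proof.
move=> pf /divides_polyC h; rewrite -[c]mulr1; apply: (is_gcd_mul gcdA pf) => _ [i ->].
by have := h i; rewrite coefCM.
Qed.

Lemma size_sub_lead f : f != 0 ->
  (size (f - lead_coef f *: 'X^((size f).-1))%R < size f)%N.
Proof.
move=> f0; have sf : (0 < size f)%N by rewrite size_poly_gt0.
rewrite -[X in (_ < X)%N](prednK sf) ltnS; apply/leq_sizeP => i.
rewrite leq_eqVlt => /predU1P[<-|ilt].
  by rewrite coefB coefZ coefXn eqxx mulr1 subrr.
rewrite coefB coefZ coefXn gtn_eqF // mulr0 subr0 nth_default //.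
by rewrite -(prednK sf).
Qed.

(** Gauss's lemma, with leading coefficients in the place of prime factors.  A
   common divisor d of f * h and of the leading coefficient of f divides
   (f - lead term) * h, hence, by induction, the content of f - lead term, hence
   the content of f.  So a divisor of f * h is coprime to both leading
   coefficients, while dividing their product. *)
Lemma primitiveM f h : primitive f -> primitive h -> primitive (f * h).
Proof.
have [m] := ubnP (size f + size h)%N.
elim: m f h => // m IH f h lt_m pf ph.
have lead_unit (f1 h1 : {poly A}) d : (size f1 + size h1 <= m)%N ->
    primitive f1 -> primitive h1 ->
    divides d%:P (f1 * h1) -> divides d (lead_coef f1) -> divides d 1.
  move=> le_m pf1 ph1 dfh dl; apply: (primitive_unit pf1).
  pose f2 := f1 - lead_coef f1 *: 'X^((size f1).-1).
  have dt : divides d%:P (lead_coef f1 *: 'X^((size f1).-1)).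
    by apply/divides_polyC => i; rewrite coefZ; exact: divides_mulr.
  rewrite -[f1](subrK (lead_coef f1 *: 'X^((size f1).-1))) -/f2; apply: dividesD => //.
  have [->|f20] := eqVneq f2 0; first exact: divides0.
  have [c [f3 [c0 ef3 pf3]]] := primitive_part f20.
  have lt3 : (size f3 + size h1 < m)%N.
    apply: leq_trans le_m; rewrite -addSn leq_add2r.
    by rewrite -(size_scale f3 c0) -mul_polyC -ef3 size_sub_lead // primitive_neq0.
  rewrite ef3; apply: divides_mulr; apply/divides_polyC => i; rewrite coefC.
  case: eqP => _; last exact: divides0.
  apply: (divides_polyC_primitive (IH _ _ lt3 pf3 ph1)).
  by rewrite mulrA -ef3 mulrBl; apply: dividesB => //; exact: divides_mulr.
rewrite ltnS in lt_m; apply: primitiveP => a afh.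
have ah : divides a (lead_coef h).
  apply: (@coprime_divides _ gcdA _ (lead_coef f)).
    apply/is_gcd_pair; split=> [||d da dl]; try by eexists; rewrite mulr1.
    apply: (lead_unit f h) => //; apply: divides_trans afh.
    by have [q ->] := da; exists q%:P; rewrite polyCM.
  by rewrite -lead_coefM lead_coefE; move/divides_polyC: afh; exact.
by apply: (lead_unit h f) => //; rewrite 1?addnC // mulrC.
Qed.

(** If a * g = f * q, the content of q takes all of a, by Gauss's lemma. *)
Lemma divides_primitive a f g : a != 0 -> primitive f ->
  divides f (a%:P * g) -> divides f g.
Proof.
move=> a0 pf [q e]; have [->|g0] := eqVneq g 0; first exact: divides0.
have q0 : q != 0.
  apply/eqP => q0; move/eqP: e; rewrite q0 mul0r mulf_eq0 polyC_eq0.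
  by rewrite (negPf a0) (negPf g0).
have [c [q1 [c0 eq1 pq1]]] := primitive_part q0.
have [b eb] : divides a c.
  apply: (divides_polyC_primitive (primitiveM pq1 pf)).
  by rewrite mulrA -eq1 -e; apply: divides_mulr; exact: dividesxx.
have aP0 : a%:P != 0 by rewrite polyC_eq0.
exists (b%:P * q1); apply: (mulfI aP0).
by rewrite e eq1 eb polyCM; ring.
Qed.

(** Euclid's algorithm with pseudo-remainders, made primitive at each step: the
   constants introduced by pseudo-division and by dividing out the content do not
   change the common divisors, since these are primitive. *)
Lemma primitive_gcd f g : primitive f -> primitive g ->
  exists d : {poly A}, is_gcd (pair_set f g) d.
Proof.
have [m] := ubnP (size g).
elim: m f g => // m IH f g lt_m pf pg.
have g0 := primitive_neq0 pg.
have /esym := Pdiv.Idomain.divp_eq f g; set a := _ ^+ _ => edv.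
have a0 : a != 0 by rewrite expf_neq0 // lead_coef_eq0.
have [r0|r0] := eqVneq (f %% g) 0.
  exists g; apply/is_gcd_pair; split=> //; last exact: dividesxx.
  apply: (divides_primitive a0 pg); rewrite mul_polyC -edv r0 addr0.
  by apply: divides_mull; exact: dividesxx.
have [c [r [c0 er pr]]] := primitive_part r0.
have [|d /is_gcd_pair[dg dr dm]] := IH g r _ pg pr.
  have /eqP <- : size (f %% g) == size r.
    by rewrite er mul_polyC size_scale.
  rewrite ltnS in lt_m; apply: leq_trans lt_m.
  by rewrite Pdiv.Idomain.ltn_modp.
exists d; apply/is_gcd_pair; split=> // [|k kf kg].
  apply: (divides_primitive a0 (primitive_divisor pg dg)).
  rewrite mul_polyC -edv er; apply: dividesD; exact: divides_mull.
apply: dm => //; apply: (divides_primitive c0 (primitive_divisor pg kg)).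
rewrite -er; have -> : f %% g = a%:P * f - f %/ g * g.
  by rewrite mul_polyC -edv addrC addKr.
by apply: dividesB; apply: divides_mull.
Qed.

Lemma poly_gcd_domain : gcd_domain {poly A}.
Proof.
move=> f g; have [->|f0] := eqVneq f 0.
  exists g; apply/is_gcd_pair; split=> //; [exact: divides0 | exact: dividesxx].
have [->|g0] := eqVneq g 0.
  exists f; apply/is_gcd_pair; split=> //; [exact: dividesxx | exact: divides0].
have [a [f1 [a0 ef pf]]] := primitive_part f0.
have [b [g1 [b0 eg pg]]] := primitive_part g0.
have [c /is_gcd_pair[[a' ea] [b' eb] cm]] := gcdA a b.
have [d /is_gcd_pair[df dg dm]] := primitive_gcd pf pg.
have mulD (x y x' y' : {poly A}) : divides x x' -> divides y y' -> divides (x * y) (x' * y').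
  by move=> [p ->] [q ->]; exists (p * q); ring.
exists (c%:P * d); apply/is_gcd_pair; split=> [||k kf kg].
- by rewrite ef; apply: mulD => //; exists a'%:P; rewrite ea polyCM.
- by rewrite eg; apply: mulD => //; exists b'%:P; rewrite eb polyCM.
have k0 : k != 0 by apply: contraNneq f0 => k0; move: kf; rewrite k0 => /divides0P ->.
have [e [k1 [e0 ek pk]]] := primitive_part k0.
have ek' : divides e%:P k by rewrite ek; apply: divides_mulr; exact: dividesxx.
have k1k : divides k1 k by rewrite ek; apply: divides_mull; exact: dividesxx.
rewrite ek; apply: mulD.
  have [q ->] : divides e c; last by exists q%:P; rewrite polyCM.
  apply: cm.
    by apply: (divides_polyC_primitive pf); rewrite -ef; exact: divides_trans kf.
  by apply: (divides_polyC_primitive pg); rewrite -eg; exact: divides_trans kg.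
apply: dm.
  by apply: (divides_primitive a0 pk); rewrite -ef; exact: divides_trans kf.
by apply: (divides_primitive b0 pk); rewrite -eg; exact: divides_trans kg.
Qed.

End PolyGcd.

(** * Laurent polynomial rings are GCD domains *)

(** B is a localisation of A: every element of B is an element of A up to a unit of B
   that comes from A.  Divisibility in B is divisibility in A after multiplication by
   such a unit, and gcds in A commute with these multiplications. *)
Lemma localisation_gcd_domain (A B : idomainType) (phi : {rmorphism A -> B}) :
  injective phi ->
  (forall b, exists s a, phi s \is a GRing.unit /\ phi s * b = phi a) ->
  gcd_domain A -> gcd_domain B.
Proof.
move=> phi_inj loc gcdA x y.
have [s [a [su ea]]] := loc x; have [t [b [tu eb]]] := loc y.
have [d dg] := gcdA (t * (s * a)) (s * (t * b)).
have [e eg] := gcdA a b.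
have divV (c u z : B) : u \is a GRing.unit -> divides c (u * z) <-> divides c z.
  move=> uu; split; last exact: divides_mull.
  by move=> /(divides_mull u^-1); rewrite mulKr.
have [ea' eb' em] := (is_gcd_pair _ _ _).1 eg.
exists (phi e); apply/is_gcd_pair; split=> [||c cx cy].
- by apply/(divV _ _ _ su); rewrite ea; have [q ->] := ea'; exists (phi q); rewrite rmorphM.
- by apply/(divV _ _ _ tu); rewrite eb; have [q ->] := eb'; exists (phi q); rewrite rmorphM.
have [r [c' [ru ec]]] := loc c.
have pull (z : A) : divides c (phi z) ->
    exists2 k, phi k \is a GRing.unit & divides c' (k * z).
  move=> [q eq]; have [k [q' [ku eq']]] := loc q.
  exists (r * k); first by rewrite rmorphM unitrM ru.
  exists q'; apply: phi_inj.
  by rewrite !rmorphM eq -ec -eq' [phi r * _]mulrC mulrACA.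
have [k ku ka] : exists2 k, phi k \is a GRing.unit & divides c' (k * a).
  by apply: pull; rewrite -ea; exact: divides_mull.
have [m mu mb] : exists2 k, phi k \is a GRing.unit & divides c' (k * b).
  by apply: pull; rewrite -eb; exact: divides_mull.
have kmg := is_gcd_pairM gcdA (k * m) eg.
have [_ _ kmm] := (is_gcd_pair _ _ _).1 kmg.
have [q eq] : divides c' (k * m * e).
  by apply: kmm; [rewrite mulrAC; exact: divides_mulr | rewrite -mulrA; exact: divides_mull].
apply/(divV _ (phi (k * m))); first by rewrite rmorphM unitrM ku.
by exists (phi q * phi r); rewrite -rmorphM eq rmorphM -mulrA ec.
Qed.

Section Laurent.
Variables (R : idomainType) (H : freeAbGroupType).
Local Notation Lambda := (fsum R H).
Local Notation r := (@frank H).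
Implicit Types (h : H) (x : Lambda) (k i : nat).

Lemma fexp_surj (v : 'rV[int]_r) : exists h : H, fexp h = v.
Proof. by have [f _ fK] := @fexp_bij H; exists (f v). Qed.

Lemma fexp1 : fexp (1%g : H) = 0.
Proof. by apply: (addrI (fexp (1%g : H))); rewrite -fexpM mulg1 addr0. Qed.

Lemma fexpX h i : fexp (h ^+ i)%g = fexp h *+ i.
Proof. by elim: i => [|i IH]; rewrite ?expg0 ?fexp1 // expgS fexpM IH mulrS. Qed.

Lemma fUX h i : fU R (h ^+ i)%g = fU R h ^+ i.
Proof. by elim: i => [|i IH]; rewrite ?expg0 // expgS fUM IH exprS. Qed.

Lemma fU_unit h : (fU R h : Lambda) \is a GRing.unit.
Proof. by apply/unitrPr; exists (fU R h^-1%g); rewrite -fUM mulgV. Qed.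

Lemma fcoefMU x h h' : fcoef (x * fU R h) (h' * h)%g = fcoef x h'.
Proof.
elim/fsum_ind: x => [u|c x y ex ey|].
- by rewrite -fUM !fcoefU (can_eq (mulgK h)).
- by rewrite mulrDl fcoefD -scalerAl fcoefZ ex ey fcoefD fcoefZ.
- by rewrite mul0r !fcoef0.
Qed.

Lemma fexpV h : fexp h^-1%g = - fexp h.
Proof. by apply: (addrI (fexp h)); rewrite -fexpM mulgV fexp1 subrr. Qed.

(** The polynomial subring in the first k of the coordinate monomials of Lambda:
   phi is its inclusion.  Substituting the next monomial t for 'X extends phi to
   polynomials over A, and injectively so, because the exponents of t separate
   the coefficients. *)
Lemma laurent_poly_subring (gcdR : gcd_domain R) k : (k <= r)%N ->
  exists (A : idomainType) (phi : {rmorphism A -> Lambda}),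
    [/\ gcd_domain A, injective phi,
        forall a h (i : 'I_r), fcoef (phi a) h != 0 -> (k <= i)%N -> fexp h 0 i = 0 &
        forall c h, (forall i : 'I_r, 0 <= fexp h 0 i) ->
          (forall i : 'I_r, (k <= i)%N -> fexp h 0 i = 0) ->
          exists a, phi a = c *: fU R h].
Proof.
elim: k => [_|k IH lt_k].
  exists R, (in_alg Lambda).
  have coefA (a : R) h : fcoef (in_alg Lambda a) h = a * (h == 1%g)%:R.
    by rewrite fcoefZ -fU1 fcoefU.
  split=> //.
  - move=> a b /fsumP /(_ 1%g); rewrite !coefA eqxx !mulr1; exact.
  - move=> a h i; rewrite coefA; have [->|_] := eqVneq h 1%g.
      by rewrite fexp1 mxE.
    by rewrite mulr0 eqxx.
  - move=> c h _ h0; exists c; have -> : h = 1%g; last by [].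
    by apply: fexp_inj; rewrite fexp1; apply/rowP => i; rewrite mxE h0.
have [A [phi [gcdA phi_inj supp img]]] := IH (ltnW lt_k).
pose ik := Ordinal lt_k; have [t et] := fexp_surj (delta_mx 0 ik).
have cphi : commr_rmorph phi (fU R t) by move=> a; apply: mulrC.
pose Phi : {rmorphism {poly A} -> Lambda} := horner_morph cphi.
have fexp_t h (i : 'I_r) j : fexp (h * (t ^+ j)^-1)%g 0 i = fexp h 0 i - (i == ik)%:R *+ j.
  by rewrite fexpM fexpV fexpX et !mxE mulmxnE mxE.
have coefPhi p h : fcoef (Phi p) h =
    \sum_(i < size p) fcoef (phi p`_i) (h * (t ^+ i)^-1)%g.
  rewrite /Phi /= /horner_morph (@horner_coef_wide _ (size p)) ?size_poly //.
  rewrite fcoef_sum; apply: eq_bigr => i _.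
  by rewrite coef_map -fUX -{1}[h](mulgVK (t ^+ i)%g) fcoefMU.
exists {poly A}, Phi; split; first exact: poly_gcd_domain.
- apply: raddf_inj => p p0; apply/polyP => i; rewrite coef0.
  have [lt_i|ge_i] := ltnP i (size p); last exact: nth_default.
  apply: phi_inj; rewrite rmorph0; apply/fsumP => h; rewrite fcoef0.
  apply/eqP; apply: contraT => /[dup] nz /supp /(_ (leqnn k : k <= ik)%N) hk.
  move/fsumP: p0 => /(_ (h * t ^+ i)%g); rewrite fcoef0 coefPhi.
  rewrite (bigD1 (Ordinal lt_i)) //= mulgK big1 ?addr0; first by move=> e; rewrite e eqxx in nz.
  move=> j ji; apply/eqP; apply: contraT => /supp /(_ (leqnn k : k <= ik)%N).
  rewrite fexp_t fexpM fexpX mxE hk add0r et mulmxnE mxE !eqxx /=.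
  move/eqP; rewrite subr_eq0 eqr_nat => /eqP eij.
  by case/eqP: ji; apply: val_inj.
- move=> p h i; rewrite coefPhi => nz lt_ki.
  have /existsP[j nzj] : [exists j : 'I_(size p), fcoef (phi p`_j) (h * (t ^+ j)^-1)%g != 0].
    apply: contraR nz; rewrite negb_exists => /forallP z.
    by rewrite big1 // => j _; apply/eqP/negPn.
  have := supp _ _ i nzj (ltnW lt_ki); rewrite fexp_t.
  by rewrite -val_eqE /= gtn_eqF // mul0rn subr0.
- move=> c h h_ge0 h_0; pose m := absz (fexp h 0 ik).
  have [||a ea] := img c (h * (t ^+ m)^-1)%g.
  + move=> i; rewrite fexp_t; case: eqP => [->|_]; last by rewrite mul0rn subr0.
    by rewrite natz gez0_abs // subrr.
  + move=> i; rewrite fexp_t leq_eqVlt => /predU1P[ki|lt_ki].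
      have -> : i = ik by apply: val_inj.
      by rewrite eqxx natz gez0_abs // subrr.
    by rewrite -val_eqE /= gtn_eqF // mul0rn subr0 h_0.
  exists (a%:P * 'X^m); rewrite rmorphM rmorphXn /= horner_morphX horner_morphC ea.
  by rewrite -fUX -scalerAl -fUM mulgVK.
Qed.

(** A monomial clears the negative exponents, so Lambda is a localisation of its
   polynomial subring. *)
Lemma laurent_gcd_domain : gcd_domain R -> gcd_domain Lambda.
Proof.
move=> /laurent_poly_subring /(_ _ (leqnn r)) [A [phi [gcdA phi_inj _ img]]].
have {}img c h : (forall i : 'I_r, 0 <= fexp h 0 i) -> exists a, phi a = c *: fU R h.
  by move=> h0; apply: img => // i; rewrite leqNgt ltn_ord.
apply: (localisation_gcd_domain phi_inj _ gcdA).
elim/fsum_ind => [h|c x y [s [a [su ea]]] [s' [b [su' eb]]]|]; last first.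
- by exists 1, 0; rewrite rmorph1 unitr1 mulr0 rmorph0.
- have [c' ec] : exists c', phi c' = c *: fU R 1%g.
    by apply: img => i; rewrite fexp1 mxE lexx.
  exists (s * s'), (s' * (c' * a) + s * b); rewrite !rmorphM unitrM su su'; split=> //.
  rewrite rmorphD !rmorphM -ea -eb ec -mulr_algl fU1; ring.
have [u eu] := fexp_surj (\row_i `|fexp h 0 i|).
have [i|s es] := img 1 u; first by rewrite eu mxE.
have [i|a ea] := img 1 (u * h)%g.
  by rewrite fexpM eu !mxE -lerBlDr sub0r -normrN ler_norm.
exists s, a; rewrite es ea !scale1r fUM; split=> //; exact: fU_unit.
Qed.

End Laurent.

(** * Complementary minors *)

Section Minors.
Variable A : comNzRingType.

Lemma split_perm n m (d : 'I_n -> 'I_(n + m)) (c : 'I_m -> 'I_(n + m)) :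
  injective d -> injective c -> (forall i j, d i != c j) ->
  exists s : 'S_(n + m), (forall i, s (lshift m i) = d i) /\ (forall j, s (rshift n j) = c j).
Proof.
move=> dI cI dc; pose F k := match split k with inl i => d i | inr j => c j end.
have FI : injective F.
  move=> k k' e; rewrite -(splitK k) -(splitK k'); congr unsplit; move: e; rewrite /F.
  case: (split k) (split k') => [i|j] [i'|j'] e.
  - by rewrite (dI _ _ e).
  - by have := dc i j'; rewrite e eqxx.
  - by have := dc i' j; rewrite e eqxx.
  - by rewrite (cI _ _ e).
exists (perm FI); split=> i; rewrite permE /F.
  by rewrite -[lshift m i]/(unsplit (inl i)) unsplitK.
by rewrite -[rshift n i]/(unsplit (inr i)) unsplitK.
Qed.

Lemma complementary_selection n m (c : 'I_m -> 'I_(n + m)) : injective c ->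
  exists d : 'I_n -> 'I_(n + m), injective d /\ forall i j, d i != c j.
Proof.
move=> cI; pose S := ~: [set c j | j : 'I_m].
have cardS : #|S| = n.
  by apply: (@addnI m); rewrite -{1}[m]card_ord -(card_imset predT cI) cardsC card_ord addnC.
exists (fun i => enum_val (cast_ord (esym cardS) i)); split.
  by move=> i i' /enum_val_inj /cast_ord_inj.
move=> i j; have := enum_valP (cast_ord (esym cardS) i).
by rewrite inE; apply: contraNneq => ->; apply/imsetP; exists j.
Qed.

Section Complementary.
Variables (n m : nat) (d : 'I_n -> 'I_(n + m)) (c : 'I_m -> 'I_(n + m)).
Variable s : 'S_(n + m).
Hypotheses (sd : forall i, s (lshift m i) = d i) (sc : forall j, s (rshift n j) = c j).

Let dI : injective d.
Proof. by move=> i i'; rewrite -!sd => /perm_inj /lshift_inj. Qed.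

Let cI : injective c.
Proof. by move=> j j'; rewrite -!sc => /perm_inj /rshift_inj. Qed.

Let dc i j : d i != c j.
Proof. by rewrite -sd -sc (inj_eq perm_inj) eq_lrshift. Qed.

(** Bringing the columns d to the front makes the matrix block triangular, with an
   identity block. *)
Lemma det_select_rows (N : 'M[A]_(m, n + m)) :
  \det (colsub c N) =
  (-1) ^+ s * \det (col_mx (\matrix_(i < n, k < n + m) (k == d i)%:R) N).
Proof.
set X := col_mx _ _.
have -> : (-1) ^+ s * \det X = \det (col_perm s X).
  by rewrite col_permE det_mulmx det_perm odd_permV mulrC.
have -> : col_perm s X = block_mx 1%:M 0 (colsub d N) (colsub c N).
  apply/matrixP => i k; rewrite mxE -(splitK i) -(splitK k).
  case: (split i) (split k) => [i'|i'] [k'|k'] /=.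
  - by rewrite sd col_mxEu block_mxEul !mxE (inj_eq dI) eq_sym.
  - by rewrite sc col_mxEu block_mxEur !mxE eq_sym (negPf (dc _ _)).
  - by rewrite sd col_mxEd block_mxEdl !mxE.
  - by rewrite sc col_mxEd block_mxEdr !mxE.
by rewrite det_lblock det1 mul1r.
Qed.

Lemma det_select_cols (B : 'M[A]_(n + m, n)) :
  \det (rowsub d B) =
  (-1) ^+ s * \det (row_mx B (\matrix_(k < n + m, j < m) (k == c j)%:R)).
Proof.
set X := row_mx _ _.
have -> : (-1) ^+ s * \det X = \det (row_perm s X).
  by rewrite row_permE det_mulmx det_perm.
have -> : row_perm s X = block_mx (rowsub d B) 0 (rowsub c B) 1%:M.
  apply/matrixP => i k; rewrite mxE -(splitK i) -(splitK k).
  case: (split i) (split k) => [i'|i'] [k'|k'] /=.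
  - by rewrite sd row_mxEl block_mxEul !mxE.
  - by rewrite sd row_mxEr block_mxEur !mxE (negPf (dc _ _)).
  - by rewrite sc row_mxEl block_mxEdl !mxE.
  - by rewrite sc row_mxEr block_mxEdr !mxE (inj_eq cI).
by rewrite det_lblock det1 mulr1.
Qed.

(** Product of the square matrices [S; N] and [B | columns c of the identity],
   block triangular since N *m B = 0. *)
Lemma complementary_minors (N : 'M[A]_(m, n + m)) (B : 'M[A]_(n + m, n))
    (S : 'M[A]_(n, n + m)) :
  N *m B = 0 ->
  \det (col_mx S N) * \det (rowsub d B) = (-1) ^+ s * (\det (S *m B) * \det (colsub c N)).
Proof.
move=> NB; rewrite det_select_cols mulrCA -det_mulmx mul_col_row NB.
rewrite det_ublock; congr (_ * (_ * \det _)).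
apply/matrixP => i j; rewrite !mxE (bigD1 (c j)) //= big1 ?addr0 => [|k /negPf kc].
  by rewrite mxE eqxx mulr1.
by rewrite mxE kc mulr0.
Qed.

End Complementary.

End Minors.

(** Expanding along the rows of S leaves the maximal minors of N. *)
Lemma divides_det_col_mx (A : idomainType) (a : A) n m
    (S : 'M[A]_(n, n + m)) (N : 'M[A]_(m, n + m)) :
  (forall g : 'I_m -> 'I_(n + m), {homo g : i j / (i < j)%N} ->
     divides a (\det (colsub g N))) ->
  divides a (\det (col_mx S N)).
Proof.
elim: n S N => [|n IH] S N aN.
  have -> : col_mx S N = N.
    by apply/matrixP => i j; rewrite mxE; case: splitP => [[]//|k ek]; congr (N _ _); apply: val_inj.
  have -> : N = colsub id N by apply/matrixP => i j; rewrite mxE.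
  exact: aN.
rewrite (expand_det_row _ ord0); apply: divides_sum => j _; apply: divides_mull.
rewrite /cofactor; apply/divides_sign.
have -> : row' ord0 (col' j (col_mx S N)) = col_mx (row' ord0 (col' j S)) (col' j N) :> 'M_(n + m).
  have e0 (i : 'I_n) : lift ord0 (lshift m i) = lshift m (lift ord0 i) by apply: val_inj.
  have eS (i : 'I_m) : lift ord0 (rshift n i) = rshift n.+1 i by apply: val_inj.
  apply/matrixP => i k; rewrite [LHS]mxE [LHS]mxE -(splitK i).
  case: (split i) => i' /=.
    by rewrite e0 !col_mxEu !mxE.
  by rewrite eS !col_mxEd !mxE.
apply: IH => g g_incr.
have -> : colsub g (col' j N) = colsub (lift j \o g) N by apply/matrixP => i k; rewrite !mxE.
apply: aN => i k ik; rewrite /= ltnNge leq_bump2 -ltnNge; exact: g_incr.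
Qed.

Lemma ord_homo_inj m q (g : 'I_m -> 'I_q) : {homo g : i j / (i < j)%N} -> injective g.
Proof.
move=> g_incr i j e; apply/val_inj; case: (ltngtP i j) => // /g_incr; rewrite e ltnn //.
Qed.

(** [complementary_minors] compares the minors of M with those of its columns c, once
   with S selecting the complement of a given minor, once with S = C. *)
Lemma gcd_minors (A : idomainType) (gcdA : gcd_domain A) p q m n (M : 'M[A]_(p, q))
    (B : 'M[A]_(q, n)) (C : 'M[A]_(n, q)) (d : 'I_n -> 'I_q) (c : 'I_m -> 'I_q) (a Q : A) :
  q = (n + m)%N -> injective d -> injective c -> (forall i j, d i != c j) ->
  M *m B = 0 -> \det (rowsub d B) != 0 ->
  is_gcd (is_minor m M) a -> is_gcd (is_minor m (colsub c M)) Q ->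
  exists2 u, divides u (\det (C *m B)) & a * \det (rowsub d B) = u * Q.
Proof.
move=> eq; subst q => dI cI dc MB; set D := \det _ => D0 a_gcd Q_gcd.
have subE f (g : 'I_m -> 'I_(n + m)) : mxsub f g M = colsub g (rowsub f M).
  by apply/matrixP => i j; rewrite !mxE.
have NB (f : 'I_m -> 'I_p) : rowsub f M *m B = 0.
  by rewrite mul_rowsub_mx MB; apply/matrixP => i j; rewrite !mxE.
have [s [sd sc]] := split_perm dI cI dc.
have QDa : divides Q (D * a).
  apply: (is_gcd_mul gcdA a_gcd) => _ [f [g [f_incr g_incr ->]]].
  have [d' [d'I d'g]] := complementary_selection (ord_homo_inj g_incr).
  have [s' [sd' sg']] := split_perm d'I (ord_homo_inj g_incr) d'g.
  rewrite subE (det_select_rows sd' sg') mulrCA; apply/divides_sign.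
  rewrite mulrC (complementary_minors sd sc _ (NB f)); apply/divides_sign.
  apply: divides_mull; case: Q_gcd => Qm _; apply: Qm.
  by exists f, id; split=> //; congr (\det _); apply/matrixP => i j; rewrite !mxE.
have aDPQ : divides (a * D) (\det (C *m B) * Q).
  apply: (is_gcd_mul gcdA Q_gcd) => _ [f [g [f_incr g_incr ->]]].
  have -> : mxsub f g (colsub c M) = colsub (c \o g) (rowsub f M).
    by apply/matrixP => i j; rewrite !mxE.
  have dcg i j : d i != (c \o g) j by exact: dc.
  have [s' [sd' scg']] := split_perm dI (inj_comp cI (ord_homo_inj g_incr)) dcg.
  apply/(divides_sign s'); rewrite -(complementary_minors sd' scg' _ (NB f)).
  rewrite mulrC [X in divides _ X]mulrC; apply/divides_mul2l => //.
  apply: divides_det_col_mx => h h_incr; case: a_gcd => am _; apply: am.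
  by exists f, h; split=> //; rewrite subE.
(* For Q = 0 nothing can be cancelled, but then a = 0 as well. *)
have [Q0|Q0] := eqVneq Q 0.
  exists 1; first by exists (\det (C *m B)); rewrite mulr1.
  by move: QDa; rewrite Q0 mulr0 mulrC => /divides0P.
have [u eu] := QDa; exists u; last by rewrite mulrC.
have [k ek] := aDPQ; exists k; apply: (mulIf Q0).
by rewrite ek [a * D]mulrC eu mulrA.
Qed.

(** * Fox calculus *)

Section Fox.
Variables (G : groupType) (s : nat) (g : 'I_s -> G).

Lemma fox_fundamental (w : word s) :
  1 - fU int (word_val g w) = \sum_j fox g j w * (1 - fU int (g j)).
Proof.
elim: w => [|[i b] w IH].
  by rewrite /= fU1 subrr big1 // => j _; rewrite mul0r.
rewrite /= fUM; set x := fU int (letter_val g (i, b)).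
under eq_bigr do rewrite mulrDl -mulrA.
rewrite big_split /= -mulr_sumr -IH (bigD1 i) //= big1 => [|j /negPf ji].
  rewrite /fox_letter eqxx /= addr0 [x * (_ - _)]mulrBr mulr1 addrA; congr (_ - _).
  rewrite /x /letter_val /=; case: b {x} => /=; last by rewrite mul1r subrK.
  by rewrite mulNr mulrBr mulr1 -fUM mulVg fU1 opprB subrK.
by rewrite /fox_letter /= eq_sym ji mul0r.
Qed.

Lemma relator_val l (r : 'I_l -> word s) k : presents g r -> word_val g (r k) = 1%g.
Proof.
move=> [_ eqv]; have -> : 1%g = word_val g [::] by [].
by apply/eqv; have := WRelator r [::] [::] k; rewrite cats0.
Qed.

Lemma alexander_fundamental l (r : 'I_l -> word s) i : presents g r ->
  \sum_j alexander_mx g r i j * (1 - fU int (g j)) = 0.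
Proof.
move=> pres; under eq_bigr do rewrite mxE.
by rewrite -fox_fundamental (relator_val _ pres) fU1 subrr.
Qed.

End Fox.

(** * The twisted extension of scalars *)

Section Psi.
Variables (G : groupType) (R : idomainType) (V : lmodType R) (n : nat).
Variables (e : module_basis V n) (rho : G -> {linear V -> V}).
Variables (H : freeAbGroupType) (pi : G -> H).
Local Notation Lambda := (fsum R H).
Local Notation psi := (psi e rho pi).
Local Notation rhobar := (rhobar e rho).

Definition psi_elt x : 'M[Lambda]_n := \matrix_(i, j) (rhobar x i j *: fU R (pi x)).

(** psi is the extension of psi_elt to the free Z-module on G; this gives its
   additivity. *)
Lemma psi_fext a : psi a = fext (psi_elt : G -> zmodule 'M[Lambda]_n) a.
Proof. by []. Qed.

Lemma psiU x : psi (fU int x) = psi_elt x.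
Proof. by rewrite psi_fext fextU. Qed.

Lemma psi_linear c a b : psi (c *: a + b) = psi a *~ c + psi b.
Proof. by rewrite !psi_fext linearP. Qed.

Lemma psi0 : psi 0 = 0.
Proof. by rewrite psi_fext linear0. Qed.

Lemma psiB a b : psi (a - b) = psi a - psi b.
Proof. by rewrite !psi_fext linearB. Qed.

Lemma psi_sum (I : finType) (F : I -> fsum int G) : psi (\sum_i F i) = \sum_i psi (F i).
Proof. by rewrite psi_fext linear_sum. Qed.

Lemma bcoord_basis k : bcoord e (e k) = delta_mx 0 k.
Proof.
rewrite -[RHS](bcoordK e); congr bcoord.
rewrite (bigD1 k) //= mxE !eqxx scale1r big1 ?addr0 // => i /negPf ik.
by rewrite mxE ik andbF scale0r.
Qed.

Lemma mulmxzr p q m (M : 'M[Lambda]_(p, q)) (N : 'M[Lambda]_(q, m)) c :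
  M *m (N *~ c) = (M *m N) *~ c.
Proof. by rewrite -!scaler_int scalemxAr. Qed.

Lemma mulmxzl p q m (M : 'M[Lambda]_(p, q)) (N : 'M[Lambda]_(q, m)) c :
  (M *~ c) *m N = (M *m N) *~ c.
Proof. by rewrite -!scaler_int scalemxAl. Qed.

Lemma rho_pi_psi (w : 'rV[Lambda]_n) x : rho_pi e rho pi x w = w *m psi_elt x.
Proof.
apply/rowP => j; rewrite /rho_pi summxE mxE; apply: eq_bigr => k _.
by rewrite !mxE -!scalerAr mulrC.
Qed.

Lemma ract_psi (w : 'rV[Lambda]_n) a : ract e rho pi w a = w *m psi a.
Proof.
have ractE b : ract e rho pi w b =
  fext (fun x => rho_pi e rho pi x w : zmodule 'rV[Lambda]_n) b by [].
elim/fsum_ind: a => [x|c a b ea eb|].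
- by rewrite ractE fextU rho_pi_psi psiU.
- by rewrite psi_linear mulmxDr mulmxzr -ea -eb !ractE linearP.
- by rewrite ractE linear0 psi0 mulmx0.
Qed.

Lemma tens_basis k : tens e 1 (e k) = delta_mx 0 k :> 'rV[Lambda]_n.
Proof. by apply/rowP => i; rewrite !mxE bcoord_basis mxE scaler_nat. Qed.

(** The basis vector 1 (x) e_k is the k-th unit row, which [ract_psi] sends to the k-th
   row of psi. *)
Lemma d2_mx_psi s l (g : 'I_s -> G) (r : 'I_l -> word s) :
  d2_mx e rho pi g r = psi_mx e rho pi (alexander_mx g r).
Proof.
apply/eq_mxblock => i j; apply/matrixP => k k'.
rewrite mxE /id_tens_d2 summxE (bigD1 i) //= eqxx big1 ?addr0 => [|i' /negPf ->].
  by rewrite ract_psi tens_basis -rowE mxE.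
by rewrite ract_psi mul0mx mxE.
Qed.

Hypothesis rho_rep : right_representation rho.
Hypothesis piM : forall a b, pi (a * b)%g = (pi a * pi b)%g.

Lemma pi1 : pi 1%g = 1%g.
Proof. by apply: (mulgI (pi 1%g)); rewrite -piM !mulg1. Qed.

Lemma rhobarM x y : rhobar (x * y)%g = rhobar x *m rhobar y.
Proof.
have [_ rhoM] := rho_rep; apply/matrixP => i j; rewrite !mxE rhoM.
rewrite -{1}(bvecK e (rho x (e i))) !linear_sum summxE; apply: eq_bigr => k _.
by rewrite !linearZ !mxE.
Qed.

Lemma rhobar1 : rhobar 1%g = 1%:M.
Proof.
have [rho_bij rhoM] := rho_rep.
have rho1 v : rho 1%g v = v by apply: (bij_inj (rho_bij 1%g)); rewrite -rhoM mulg1.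
by apply/matrixP => i j; rewrite !mxE rho1 bcoord_basis mxE eqxx eq_sym.
Qed.

Lemma det_rhobar_unit x : \det (rhobar x) \is a GRing.unit.
Proof.
apply/unitrPr; exists (\det (rhobar x^-1%g)).
by rewrite -det_mulmx -rhobarM mulgV rhobar1 det1.
Qed.

Lemma psi_eltM x y : psi_elt (x * y)%g = psi_elt x *m psi_elt y.
Proof.
apply/matrixP => i j; rewrite mxE rhobarM mxE [RHS]mxE scaler_suml.
apply: eq_bigr => k _; rewrite [psi_elt x i k]mxE [psi_elt y k j]mxE.
by rewrite -scalerAl -scalerAr scalerA piM fUM.
Qed.

Lemma psiM a b : psi (a * b) = psi a *m psi b.
Proof.
elim/fsum_ind: a => [x|c a a' ea ea'|]; last by rewrite mul0r psi0 mul0mx.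
  elim/fsum_ind: b => [y|c b b' eb eb'|]; last by rewrite mulr0 psi0 mulmx0.
    by rewrite -fUM !psiU psi_eltM.
  by rewrite mulrDr -scalerAr !psi_linear mulmxDr eb eb' mulmxzr.
by rewrite mulrDl -scalerAl !psi_linear mulmxDl ea ea' mulmxzl.
Qed.

Lemma psi1 : psi 1 = 1%:M.
Proof.
apply/matrixP => i j; rewrite -fU1 psiU mxE rhobar1 pi1 !mxE.
by rewrite scaler_nat.
Qed.

(** psi(1 - x) = 1 - pi(x) rhobar(x), and pi(x)^-1 - rhobar(x) is the characteristic
   matrix of rhobar(x), evaluated at pi(x)^-1. *)
Lemma det_psi_char_poly x :
  \det (fU R (pi x)^-1%g *: psi (1 - fU int x)) =
  \sum_(i < n.+1) (char_poly (rhobar x))`_i *: fU R ((pi x)^-1 ^+ i)%g.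
Proof.
set t := fU R (pi x)^-1%g.
have -> : t *: psi (1 - fU int x) =
    map_mx (horner_eval t) (char_poly_mx (map_mx (in_alg Lambda) (rhobar x))).
  apply/matrixP => i j; rewrite psiB psi1 psiU !mxE.
  rewrite /horner_eval !hornerE.
  by rewrite hornerMn hornerX mulrBr mulr_natr -scalerAr -fUM mulVg.
rewrite det_map_mx /= -/(char_poly _) -map_char_poly /horner_eval.
rewrite (@horner_coef_wide _ n.+1); last by rewrite (leq_trans (size_poly _ _)) ?size_char_poly.
by apply: eq_bigr => i _; rewrite coef_map /= mulr_algl fUX.
Qed.

End Psi.

(** * Elements with xi-monic ends *)

Section Monic.
Variables (RR : realType) (R : idomainType) (H : freeAbGroupType) (xi : H -> RR).
Hypothesis xiM : forall h h', xi (h * h')%g = xi h + xi h'.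
Local Notation Lambda := (fsum R H).

Lemma xi1 : xi 1%g = 0.
Proof. by apply: (addrI (xi 1%g)); rewrite -xiM mulg1 addr0. Qed.

Lemma xiX h i : xi (h ^+ i)%g = xi h *+ i.
Proof. by elim: i => [|i IH]; rewrite ?expg0 ?xi1 // expgS xiM IH mulrS. Qed.

Lemma xi_monic_neq0 (x : Lambda) : xi_monic xi x -> x != 0.
Proof.
move=> [a [c [h [c0 _ hmin _ ->]]]]; apply: contraTneq c0 => /fsumP /(_ (h ord0)).
rewrite fcoef0 fcoef_sum (bigD1 ord0) //= fcoefZ fcoefU eqxx mulr1 big1 ?addr0 => [->|i i0].
  by rewrite unitr0.
rewrite fcoefZ fcoefU; case: eqP => [e|_]; last by rewrite mulr0.
by have := hmin i i0; rewrite e ltxx.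
Qed.

Lemma xi_monic1 : xi_monic xi (1 : Lambda).
Proof.
exists 0%N, (fun=> 1), (fun=> 1%g); rewrite big_ord1 scale1r fU1.
by split=> //; rewrite ?unitr1 // => i; case/eqP; rewrite [LHS]ord1 [RHS]ord1.
Qed.

Lemma divisor_xi_monic_unit (u P : Lambda) :
  xi_monic xi P -> divides u P -> localisation_unit xi (tofrac u).
Proof.
move=> Pmon [q eP]; have := xi_monic_neq0 Pmon; rewrite -tofrac_eq0 => P0.
split; first by exists u, 1; split; [exact: xi_monic1 | rewrite rmorph1 divr1].
exists (tofrac q / tofrac P); first by exists q, P.
by rewrite mulrA -rmorphM [u * q]mulrC -eP mulfV.
Qed.

End Monic.

Section Main.
Variables (RR : realType) (G : groupType) (R : idomainType) (V : lmodType R) (n : nat).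
Variables (e : module_basis V n) (rho : G -> {linear V -> V}).
Variables (H : freeAbGroupType) (pi : G -> H) (xi : H -> RR).
Hypothesis rho_rep : right_representation rho.
Hypothesis piM : forall a b, pi (a * b)%g = (pi a * pi b)%g.
Hypothesis xiM : forall h h', xi (h * h')%g = xi h + xi h'.
Local Notation Lambda := (fsum R H).
Local Notation psi := (psi e rho pi).

(** The end coefficients of the characteristic polynomial are (-1)^n det rhobar(x)
   and 1. *)
Lemma xi_monic_det_psi x : 0 < xi (pi x)^-1%g ->
  xi_monic xi (\det (fU R (pi x)^-1%g *: psi (1 - fU int x))).
Proof.
move=> xi_gt0; rewrite (det_psi_char_poly _ rho_rep piM).
exists n, (fun i => (char_poly (rhobar e rho x))`_i), (fun i => ((pi x)^-1 ^+ i)%g).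
split=> //.
- by rewrite char_poly_det unitrM unitrX ?unitrN1 ?(det_rhobar_unit _ rho_rep).
- have /monicP := char_poly_monic (rhobar e rho x).
  by rewrite /lead_coef size_char_poly /= => ->; exact: unitr1.
- move=> i i0; rewrite !(xiX xiM) mulr0n pmulrn_lgt0 // lt0n.
  by apply: contraNneq i0 => i0; apply/eqP/val_inj.
- move=> i i0; rewrite !(xiX xiM) ltr_pMn2l // ltn_neqAle -ltnS ltn_ord andbT.
  by apply: contraNneq i0 => i0; apply/eqP/val_inj.
Qed.

(** [gcd_minors] for the matrix psi(Alexander matrix) and the column of the blocks
   psi(1 - g_i); d is the j-th block of indices and c lists the other blocks. *)
Lemma fitting_twisted_alexander s l (g : 'I_s -> G) (r : 'I_l -> word s)
    (pres : presents g r) (gcdL : gcd_domain Lambda) (x : G) (A Q : Lambda) (j : 'I_s) :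
  is_fitting_invariant e rho pi g r A ->
  \det (psi (1 - fU int (g j))) != 0 ->
  is_gcd (is_minor (n * s.-1) (psi_mx e rho pi (col' j (alexander_mx g r)))) Q ->
  exists2 u, divides u (\det (fU R (pi x)^-1%g *: psi (1 - fU int x))) &
    A * \det (psi (1 - fU int (g j))) = u * Q.
Proof.
rewrite /is_fitting_invariant d2_mx_psi => A_gcd D0 Q_gcd.
pose M := psi_mx e rho pi (alexander_mx g r).
pose B := \mxcol_(i < s) psi (1 - fU int (g i)).
have [w ew] : exists w, word_val g w = x by apply: (proj1 pres).
pose C := fU R (pi x)^-1%g *: \mxrow_(i < s) psi (fox g i w).
pose d (i : 'I_n) : 'I_(\sum_(i < s) n) := tagnat.Rank j i.
pose c (k : 'I_(\sum_(i < s.-1) n)) : 'I_(\sum_(i < s) n) :=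
  tagnat.Rank (lift j (tagnat.sig1 k)) (tagnat.sig2 k).
have CB : C *m B = fU R (pi x)^-1%g *: psi (1 - fU int x).
  rewrite -scalemxAl mul_mxrow_mxcol -ew fox_fundamental psi_sum.
  by congr (_ *: _); apply: eq_bigr => i _; rewrite psiM.
have dE : rowsub d B = psi (1 - fU int (g j)) by exact: mxcolK.
have cE : colsub c M = psi_mx e rho pi (col' j (alexander_mx g r)).
  apply/matrixP => i k; rewrite mxE -{1}(tagnat.sig2K i).
  have /matrixP/(_ (tagnat.sig2 i) (tagnat.sig2 k)) :=
    mxblockK (fun i j => psi (alexander_mx g r i j)) (tagnat.sig1 i) (lift j (tagnat.sig1 k)).
  by rewrite mxE /psi_mx => ->; rewrite [RHS]mxE [col' _ _ _ _]mxE.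
have MB : M *m B = 0.
  rewrite mul_mxblock_mxrow; apply/mxcolP => i; rewrite mxcolK submxcol0.
  under eq_bigr do rewrite -(psiM e rho_rep piM).
  by rewrite -psi_sum alexander_fundamental // psi0.
have szs : (\sum_(i < s.-1) n = n * s.-1)%N by rewrite sum_nat_const card_ord mulnC.
rewrite -szs -/M in A_gcd Q_gcd.
rewrite -CB -dE; rewrite -cE in Q_gcd; rewrite -dE in D0.
have dI : injective d.
  by move=> i i' /(congr1 val)/eqP; rewrite /= tagnat.eq_Rank eqxx => /eqP/val_inj.
have cI : injective c.
  move=> k k' /(congr1 val)/eqP; rewrite /= tagnat.eq_Rank (inj_eq lift_inj) => e12.
  by apply/val_inj/eqP; rewrite -(tagnat.sig2K k) -(tagnat.sig2K k') tagnat.eq_Rank.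
have dc i k : d i != c k.
  by rewrite -val_eqE tagnat.eq_Rank (negPf (neq_lift _ _)).
apply: (gcd_minors gcdL C _ dI cI dc MB D0 A_gcd Q_gcd).
by rewrite !sum_nat_const !card_ord -mulSn prednK //; exact: leq_ltn_trans (ltn_ord j).
Qed.

End Main.

Theorem proposition5p4
  (RR : realType) (M : topologicalType) (x0 : M)
  (M_manifold : smooth_3manifold_with_boundary RR M)
  (M_connected : connected [set: M]%classic)
  (M_compact : compact [set: M]%classic)
  (M_euler : euler_characteristic RR x0 0)
  (G : groupType) (G_pi1 : is_fundamental_group RR x0 G)
  (R : idomainType) (R_factorial : factorial_ring R)
  (V : lmodType R) (n : nat) (e : module_basis V n)
  (rho : G -> {linear V -> V}) (rho_rep : right_representation rho)
  (H : freeAbGroupType) (pi : G -> H)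
  (piM : forall a b, pi (a * b)%g = (pi a * pi b)%g)
  (pi_surj : forall h, exists a, pi a = h)
  (xi : H -> RR) (xiM : forall h h', xi (h * h')%g = xi h + xi h')
  (xi_nontrivial : exists h, xi h != 0)
  (s l : nat) (g : 'I_s -> G) (r : 'I_l -> word s) (G_pres : presents g r)
  (A : fsum R H) (A_fitting : is_fitting_invariant e rho pi g r A)
  (Delta : {fraction (fsum R H)})
  (Delta_alexander : is_twisted_alexander e rho pi g r Delta) :
  exists2 u : {fraction (fsum R H)},
    localisation_unit xi u & tofrac A = u * Delta.
Proof.
have xiV h : xi h^-1%g = - xi h by apply: (addrI (xi h)); rewrite -xiM mulgV (xi1 xiM) subrr.
(* xi(h) and xi(h^-1) are opposite, so one of them is positive. *)
have [x x_gt0] : exists x, 0 < xi (pi x)^-1%g.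
  have [h] := xi_nontrivial; rewrite neq_lt => /orP[h_lt0|h_gt0].
    by have [x ex] := pi_surj h; exists x; rewrite xiV oppr_gt0 ex.
  by have [x ex] := pi_surj h^-1%g; exists x; rewrite ex invgK.
have gcdL : gcd_domain (fsum R H) := laurent_gcd_domain (factorial_gcd_domain R_factorial).
have [j [Q [D0 Q_gcd ->]]] := Delta_alexander.
have [u uP eA] := fitting_twisted_alexander rho_rep piM G_pres gcdL x A_fitting D0 Q_gcd.
exists (tofrac u).
  exact: divisor_xi_monic_unit (xi_monic_det_psi e rho_rep piM xiM x_gt0) uP.
have D0' : tofrac (\det (psi e rho pi (1 - fU int (g j)))) != 0 by rewrite tofrac_eq0.
by rewrite mulrA -rmorphM -eA rmorphM mulfK.
Qed.
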